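(* Let $X$ and $Y$ be bounded geometry metric spaces with property A, and let $A^*(X)$ and $A^*(Y)$ be Roe-type algebras associated to $X$ and $Y$ respectively. If there exists a $*$-isomorphism $\phi:A^*(X)\to A^*(Y)$, then $X$ and $Y$ are coarsely equivalent.
   Context: A metric space $X$ has bounded geometry if for all $R\ge 0$ there is $N_R\in\mathbb{N}$ such that every ball of radius $R$ in $X$ has at most $N_R$ elements. A (not necessarily continuous) map $f:X\to Y$ of metric spaces is uniformly expansive if for all $R>0$ there is $S>0$ such that $d(x_1,x_2)\le R$ implies $d(f(x_1),f(x_2))\le S$. Two maps $f,g:X\to Y$ are close if there is $C>0$ with $d(f(x),g(x))\le C$ for all $x\in X$. $X$ and $Y$ are coarsely equivalent if there are uniformly expansive maps $f:X\to Y$ and $g:Y\to X$ such that $f\circ g$ and $g\circ f$ are close to the identity maps on $Y$ and $X$ respectively. Roe-type algebras: let $\mathcal{H}$ be a (nonzero, possibly finite dimensional) separable complex Hilbert space; the Hilbert spaces used for $X$ and for $Y$ may differ. For a bounded operator $T$ on $l^2(X,\mathcal{H})\cong l^2(X)\otimes\mathcal{H}$ write $T_{xy}$ for its $(x,y)$ matrix coefficient, a bounded operator on $\mathcal{H}$. $T$ has finite propagation if there is $S>0$ such that $T_{xy}=0$ whenever $d(x,y)\ge S$; $T$ is locally compact if every $T_{xy}$ is compact. A $*$-subalgebra of $\mathcal{B}(l^2(X,\mathcal{H}))$ is an algebraic Roe-type algebra associated to $X$ if it consists only of locally compact, finite propagation operators, and it contains every finite propagation operator $T$ for which there is $N\in\mathbb{N}$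 with $\mathrm{rank}(T_{xy})\le N$ for all $x,y\in X$. A Roe-type algebra associated to $X$ is a $C^*$-subalgebra of $\mathcal{B}(l^2(X,\mathcal{H}))$ that is the norm closure of some algebraic Roe-type algebra. Property A (Yu): for all $r>0$, $\epsilon>0$ there are finite subsets $A_x\subseteq X\times\mathbb{N}$ $(x\in X)$ with $(x,1)\in A_x$, with $|A_x\,\triangle\, A_{x'}|/|A_x\cap A_{x'}|<\epsilon$ whenever $d(x,x')\le r$, and such that there is $R>0$ with $d(y,z)\le R$ whenever $(y,m),(z,n)\in A_x$ for some $x$. For bounded geometry metric spaces it is known to be equivalent to the metric sparsification property: there is a constant $0<\kappa\le 1$ such that for all $S\ge0$ there is $D\ge0$ such that for every Borel probability measure $\mu$ on $X$ there is a subset $\Omega=\sqcup_{i\in I}\Omega_i\subseteq X$ with $\mu(\Omega)\ge\kappa$, $\mathrm{diam}(\Omega_i)\le D$ for all $i$, and $d(\Omega_i,\Omega_j)>S$ for all $i\ne j$. *)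

(* Defs.v *)
From HB Require Import structures.
From mathcomp Require Import all_boot all_order all_algebra finmap complex.
From mathcomp Require Import boolp classical_sets functions cardinality fsbigop.
From mathcomp Require Import reals ereal topology normedtype numfun esum ring lra.

Set Implicit Arguments.
Unset Strict Implicit.
Unset Printing Implicit Defensive.
Import Order.TTheory GRing.Theory Num.Theory.
Import numFieldNormedType.Exports.
Local Open Scope classical_set_scope.
Local Open Scope complex_scope.
Local Open Scope ring_scope.

Local Notation re := complex.Re.
Local Notation im := complex.Im.

Section RealSum.
Context (R : realType) (X : choiceType).
Implicit Types f g : X -> R.

Definition rsummable f := summable [set: X] (EFin \o f).

(* Unconditional sum over X (sums of the positive and negative parts as suprema
   over finite subsets); only meaningful for summable f. *)
Definition rsum f : R :=
  fine (\esum_(x in [set: X]) (EFin \o f)^\+ x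
        - \esum_(x in [set: X]) (EFin \o f)^\- x)%E.

Lemma rsummable_le f g :
  (forall x, `|f x| <= `|g x|) -> rsummable g -> rsummable f.
Proof.
by move=> fg; apply: le_lt_trans; apply: le_esum => x _; rewrite lee_fin.
Qed.

Lemma rsummableD f g : rsummable f -> rsummable g -> rsummable (f \+ g).
Proof. by move=> sf sg; have := summableD sf sg. Qed.

Lemma rsummableN f : rsummable f -> rsummable (\- f).
Proof. by apply: rsummable_le => x; rewrite normrN. Qed.

Lemma rsum_subE f g : rsummable f -> rsummable g ->
  (forall x, 0 <= f x) -> (forall x, 0 <= g x) ->
  rsum (f \- g) = rsum f - rsum g.
Proof.
have nnE h : rsummable h -> (forall x, 0 <= h x) ->
    rsum h = fine (\esum_(x in [set: X]) (h x)%:E) /\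
    (\esum_(x in [set: X]) (h x)%:E)%E \is a fin_num.
  move=> sh h0; split; last first.
    move: sh; rewrite /rsummable summableE.
    by rewrite (@eq_esum _ _ _ _ (EFin \o h))// => x _ /=; rewrite ger0_norm.
  rewrite /rsum; congr fine.
  rewrite (@eq_esum _ _ _ _ (EFin \o h)); last first.
    by move=> x _; rewrite (ge0_funeposE (D := setT)) ?inE// => y _; rewrite lee_fin.
  rewrite [X in (_ - X)%E]esum1 ?sube0// => x _.
  by rewrite (ge0_funenegE (D := setT)) ?inE// => y _; rewrite lee_fin.
move=> sf sg f0 g0; rewrite (nnE f sf f0).1 (nnE g sg g0).1.
rewrite -fineB ?(nnE _ _ _).2//; congr fine.
rewrite -(@esumB _ _ _ (EFin \o f) (EFin \o g))// => x _.
  by rewrite lee_fin.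
by rewrite lee_fin.
Qed.

Lemma rsum_ge0E f : rsummable f -> (forall x, 0 <= f x) ->
  (\esum_(x in [set: X]) (f x)%:E)%E = (rsum f)%:E.
Proof.
move=> sf f0; rewrite /rsum.
rewrite [in RHS](@eq_esum _ _ _ _ (EFin \o f)); last first.
  by move=> x _; rewrite (ge0_funeposE (D := setT)) ?inE// => y _; rewrite lee_fin.
rewrite [X in (_ - X)%E]esum1 ?sube0; last first.
  by move=> x _; rewrite (ge0_funenegE (D := setT)) ?inE// => y _; rewrite lee_fin.
rewrite fineK//.
move: sf; rewrite /rsummable summableE.
by rewrite (@eq_esum _ _ _ _ (EFin \o f))// => x _ /=; rewrite ger0_norm.
Qed.

Lemma rsum_ge0 f : rsummable f -> (forall x, 0 <= f x) -> 0 <= rsum f.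
Proof.
by move=> sf f0; rewrite -lee_fin -rsum_ge0E// esum_ge0// => x _; rewrite lee_fin.
Qed.

Lemma rsum_fin_le f (A : set X) : finite_set A -> rsummable f ->
  (forall x, 0 <= f x) -> \sum_(x \in A) f x <= rsum f.
Proof.
move=> fA sf f0; rewrite -lee_fin -rsum_ge0E// -fsumEFin//.
by apply: esum_ge; exists A.
Qed.

Lemma rsummable_bnd f (M : R) : (forall x, 0 <= f x) ->
  (forall A : set X, finite_set A -> \sum_(x \in A) f x <= M) ->
  rsummable f /\ rsum f <= M.
Proof.
move=> f0 bf.
have b : (\esum_(x in [set: X]) (f x)%:E <= M%:E)%E.
  apply: ge_ereal_sup => _ [A [fA _] <-].
  by rewrite fsumEFin// lee_fin bf.
have sf : rsummable f.
  rewrite /rsummable /summable (@eq_esum _ _ _ _ (EFin \o f)).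
    by rewrite (le_lt_trans b)// ltry.
  by move=> x _ /=; rewrite ger0_norm.
by split=> //; rewrite -lee_fin -rsum_ge0E.
Qed.

Lemma rsum_nnD f g : rsummable f -> rsummable g ->
  (forall x, 0 <= f x) -> (forall x, 0 <= g x) ->
  rsum (f \+ g) = rsum f + rsum g.
Proof.
move=> sf sg f0 g0; apply: EFin_inj.
rewrite -rsum_ge0E; [|exact: rsummableD|by move=> x; rewrite addr_ge0].
rewrite EFinD -!rsum_ge0E// -esumD// => x _; by rewrite lee_fin.
Qed.

Let pos f : X -> R := fun x => Num.max (f x) 0.
Let neg f : X -> R := fun x => Num.max (- f x) 0.

Let posnegE f : f = pos f \- neg f.
Proof.
apply/funext => x; rewrite /pos /neg /=.
have [f0|f0] := leP 0 (f x).
  by rewrite (max_r (_ : - f x <= 0)) ?oppr_le0// subr0.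
by rewrite (max_l (_ : 0 <= - f x)) ?oppr_ge0 ?ltW// sub0r opprK.
Qed.

Let pos0 f x : 0 <= pos f x. Proof. by rewrite le_max lexx orbT. Qed.
Let neg0 f x : 0 <= neg f x. Proof. by rewrite le_max lexx orbT. Qed.

Let spos f : rsummable f -> rsummable (pos f).
Proof.
apply: rsummable_le => x; rewrite ger0_norm// /pos ge_max normr_ge0.
by rewrite ler_norm.
Qed.
Let sneg f : rsummable f -> rsummable (neg f).
Proof.
apply: rsummable_le => x; rewrite ger0_norm// /neg ge_max normr_ge0.
by rewrite -normrN ler_norm.
Qed.

Let rsumE f : rsummable f -> rsum f = rsum (pos f) - rsum (neg f).
Proof. move=> sf; by rewrite {1}(posnegE f); apply: (rsum_subE (spos sf) (sneg sf)). Qed.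

Lemma rsumD f g : rsummable f -> rsummable g ->
  rsum (f \+ g) = rsum f + rsum g.
Proof.
move=> sf sg; rewrite (rsumE sf) (rsumE sg).
have -> : f \+ g = (pos f \+ pos g) \- (neg f \+ neg g).
  rewrite {1}(posnegE f) {1}(posnegE g); apply/funext => x /=.
  by rewrite opprD addrACA.
rewrite rsum_subE.
- rewrite (rsum_nnD (spos sf) (spos sg) (pos0 f) (pos0 g)).
  rewrite (rsum_nnD (sneg sf) (sneg sg) (neg0 f) (neg0 g)).
  by rewrite opprD addrACA.
- by apply: rsummableD; exact: spos.
- by apply: rsummableD; exact: sneg.
- by move=> x; rewrite addr_ge0.
- by move=> x; rewrite addr_ge0.
Qed.

Lemma rsumN f : rsummable f -> rsum (\- f) = - rsum f.
Proof.
move=> sf; rewrite (rsumE sf).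
have -> : \- f = neg f \- pos f.
  by rewrite {1}(posnegE f); apply/funext => x /=; rewrite opprB.
rewrite rsum_subE ?opprB//; [exact: sneg|exact: spos].
Qed.

Lemma rsummableZ (a : R) f : rsummable f -> rsummable (fun x => a * f x).
Proof.
move=> sf; suff [] : rsummable (fun x => `|a * f x|) /\
    rsum (fun x => `|a * f x|) <= `|a| * rsum (fun x => `|f x|).
  by move=> + _; apply: rsummable_le => x; rewrite normr_id.
apply: rsummable_bnd => [x|A fA]; first exact: normr_ge0.
have sf' : rsummable (fun x => `|f x|).
  by move: sf; apply: rsummable_le => x; rewrite normr_id.
rewrite (le_trans _ (ler_wpM2l (normr_ge0 a) (rsum_fin_le fA sf' _)))//.
by rewrite mulr_fsumr; under eq_fsbigr do rewrite normrM.
Qed.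

Lemma rsumZ (a : R) f : rsummable f -> rsum (fun x => a * f x) = a * rsum f.
Proof.
have Hle b g : 0 <= b -> rsummable g -> (forall x, 0 <= g x) ->
    rsum (fun x => b * g x) <= b * rsum g.
  move=> b0 sg g0; apply: (rsummable_bnd _ _).2 => [x|A fA].
    by rewrite mulr_ge0.
  by rewrite -mulr_fsumr ler_wpM2l// rsum_fin_le.
have Hnn b g : 0 <= b -> rsummable g -> (forall x, 0 <= g x) ->
    rsum (fun x => b * g x) = b * rsum g.
  rewrite le_eqVlt => /predU1P[<- sg g0|b0 sg g0].
    apply/eqP; rewrite eq_le (Hle _ _ (lexx 0) sg g0) mul0r rsum_ge0//.
      exact: rsummableZ.
    by move=> x; rewrite mul0r.
  have b0' := ltW b0.
  apply/eqP; rewrite eq_le Hle//= -ler_pdivlMl//.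
  have {1}-> : g = (fun x => b^-1 * (b * g x)).
    by apply/funext => x; rewrite mulKf// gt_eqF.
  apply: Hle; first by rewrite invr_ge0.
    exact: rsummableZ.
  by move=> x; rewrite mulr_ge0.
have Hp b : 0 <= b -> rsummable f -> rsum (fun x => b * f x) = b * rsum f.
  move=> b0 sf; rewrite (rsumE sf).
  have -> : (fun x => b * f x) = (fun x => b * pos f x) \- (fun x => b * neg f x).
    by apply/funext => x /=; rewrite -mulrBr {1}(posnegE f).
  rewrite rsum_subE.
  - by rewrite (Hnn _ _ b0 (spos sf) (pos0 f)) (Hnn _ _ b0 (sneg sf) (neg0 f)) mulrBr.
  - by apply: rsummableZ; exact: spos.
  - by apply: rsummableZ; exact: sneg.
  - by move=> x; rewrite mulr_ge0.
  - by move=> x; rewrite mulr_ge0.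
move=> sf; have [a0|a0] := leP 0 a; first exact: Hp.
have -> : (fun x => a * f x) = \- (fun x => - a * f x).
  by apply/funext => x /=; rewrite mulNr opprK.
rewrite rsumN ?Hp// ?oppr_ge0 ?(ltW a0) ?mulNr ?opprK//.
exact: rsummableZ.
Qed.

End RealSum.

Section ComplexSum.
Context (R : realType) (X : choiceType).
Implicit Types f g : X -> R[i].

Definition csummable f := rsummable (fun x => re `|f x|).

Definition csum f : R[i] :=
  rsum (fun x => re (f x)) +i* rsum (fun x => im (f x)).

Lemma Re_norm_ge0 (z : R[i]) : 0 <= re `|z|.
Proof. by rewrite normc_def /= sqrtr_ge0. Qed.

Lemma Re_le_norm (z : R[i]) : `|re z| <= re `|z|.
Proof.
rewrite normc_def /= -(sqrtr_sqr (re z)) ler_wsqrtr// lerDl sqr_ge0//.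
Qed.

Lemma Im_le_norm (z : R[i]) : `|im z| <= re `|z|.
Proof.
rewrite normc_def /= -(sqrtr_sqr (im z)) ler_wsqrtr// lerDr sqr_ge0//.
Qed.

Lemma csummable_Re f : csummable f -> rsummable (fun x => re (f x)).
Proof.
apply: rsummable_le => x; rewrite (ger0_norm (Re_norm_ge0 _)); exact: Re_le_norm.
Qed.

Lemma csummable_Im f : csummable f -> rsummable (fun x => im (f x)).
Proof.
apply: rsummable_le => x; rewrite (ger0_norm (Re_norm_ge0 _)); exact: Im_le_norm.
Qed.

Let reD (z w : R[i]) : re (z + w) = re z + re w.
Proof. by case: z w => [? ?] []. Qed.
Let imD (z w : R[i]) : im (z + w) = im z + im w.
Proof. by case: z w => [? ?] []. Qed.
Let reM (z w : R[i]) : re (z * w) = re z * re w + (- im z) * im w.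
Proof. by case: z w => [? ?] [? ?] /=; rewrite mulNr. Qed.
Let imM (z w : R[i]) : im (z * w) = re z * im w + im z * re w.
Proof. by case: z w => [? ?] [? ?]. Qed.

Let complex_eq (z w : R[i]) : re z = re w -> im z = im w -> z = w.
Proof. by case: z w => [? ?] [? ?] /= -> ->. Qed.

Lemma csumD f g : csummable f -> csummable g ->
  csum (fun x => f x + g x) = csum f + csum g.
Proof.
move=> sf sg; apply: complex_eq; rewrite (reD, imD).
- transitivity (rsum ((fun x => re (f x)) \+ (fun x => re (g x)))).
    by congr rsum; apply/funext => x; exact: reD.
  exact: (rsumD (csummable_Re sf) (csummable_Re sg)).
- transitivity (rsum ((fun x => im (f x)) \+ (fun x => im (g x)))).
    by congr rsum; apply/funext => x; exact: imD.
  exact: (rsumD (csummable_Im sf) (csummable_Im sg)).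
Qed.

Lemma csumZ (a : R[i]) f : csummable f ->
  csum (fun x => a * f x) = a * csum f.
Proof.
move=> sf; have sr := csummable_Re sf; have si := csummable_Im sf.
apply: complex_eq; rewrite (reM, imM).
- transitivity (rsum ((fun x => re a * re (f x)) \+
                      (fun x => - im a * im (f x)))).
    by congr rsum; apply/funext => x; exact: reM.
  by rewrite (rsumD (rsummableZ _ sr) (rsummableZ _ si)) !rsumZ.
- transitivity (rsum ((fun x => re a * im (f x)) \+
                      (fun x => im a * re (f x)))).
    by congr rsum; apply/funext => x; exact: imM.
  by rewrite (rsumD (rsummableZ _ si) (rsummableZ _ sr)) !rsumZ.
Qed.

Let reC (z : R[i]) : re (Num.conj z) = re z. Proof. by case: z. Qed.
Let imC (z : R[i]) : im (Num.conj z) = - im z. Proof. by case: z. Qed.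

Lemma csum_conj f : csummable f ->
  csum (fun x => Num.conj (f x)) = Num.conj (csum f).
Proof.
move=> sf; apply: complex_eq; rewrite (reC, imC).
- by congr rsum; apply/funext => x; exact: reC.
- rewrite -[RHS](rsumN (csummable_Im sf)).
  by congr rsum; apply/funext => x; exact: imC.
Qed.

End ComplexSum.

Section DotTheory.
Context (C : numClosedFieldType) (U : lmodType C).
Variable op : {dot U for (Num.conj : C -> C)}.

Lemma dotC u v : op u v = Num.conj (op v u).
Proof. by have := (@hermitian_subproof _ _ _ _ op u v); rewrite expr0 mul1r. Qed.

Lemma dotBl u v w : op (u - v) w = op u w - op v w.
Proof. by have /= := (@zmod_morphisml_subproof _ _ _ _ _ _ op w u v). Qed.

Lemma dotZl a u v : op (a *: u) v = a * op u v.
Proof. by have /= := (@linearl_subproof _ _ _ _ _ _ op v a u). Qed.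

Lemma dot0l v : op 0 v = 0.
Proof. by rewrite -(scale0r v) dotZl mul0r. Qed.

Lemma dotDl u v w : op (u + v) w = op u w + op v w.
Proof.
have -> : u + v = u - (0 - v) by rewrite sub0r opprK.
by rewrite !dotBl dot0l sub0r opprK.
Qed.

Lemma dotBr u v w : op u (v - w) = op u v - op u w.
Proof. by rewrite (dotC u (v - w)) dotBl (dotC u v) (dotC u w) rmorphB. Qed.

Lemma dotDr u v w : op u (v + w) = op u v + op u w.
Proof. by rewrite (dotC u (v + w)) dotDl (dotC u v) (dotC u w) rmorphD. Qed.

Lemma dotZr a u v : op u (a *: v) = Num.conj a * op u v.
Proof. by rewrite (dotC u (a *: v)) dotZl (dotC u v) rmorphM. Qed.

Lemma dot0r u : op u 0 = 0.
Proof. by rewrite dotC dot0l rmorph0. Qed.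

Lemma dot_gt0 u : u != 0 -> 0 < op u u.
Proof. exact: neq0_dnorm_gt0. Qed.

Lemma dot_ge0 u : 0 <= op u u.
Proof.
have [->|u0] := eqVneq u 0; first by rewrite dot0l.
exact/ltW/dot_gt0.
Qed.

Lemma dot_eq0 u : op u u = 0 -> u = 0.
Proof.
move=> uu0; apply/eqP/negP => /negP /dot_gt0.
by rewrite uu0 ltxx.
Qed.

Lemma dot_CS u v : `|op u v| ^+ 2 <= op u u * op v v.
Proof.
have [->|v0] := eqVneq v 0; first by rewrite !dot0r normr0 expr0n mulr0.
have a0 := dot_gt0 v0.
have := dot_ge0 (op v v *: u - op u v *: v).
rewrite dotBl !dotZl !dotBr !dotZr -(dotC v v) (dotC v u).
rewrite (_ : _ - _ = op v v * (op u u * op v v - `|op u v| ^+ 2)).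
  by rewrite pmulr_rge0// subr_ge0.
rewrite normCK; ring.
Qed.

End DotTheory.

(* Complex Hilbert spaces; the inner product is linear in its first argument. *)
HB.mixin Record CompleteNormedModule_isHilbert (R : realType) H
    & CompleteNormedModule R[i] H := {
  inner : {dot H for (Num.conj : R[i] -> R[i])} ;
  innerxx : forall v : H, inner v v = `|v| ^+ 2 ;
}.

#[short(type="hilbertType")]
HB.structure Definition Hilbert (R : realType) :=
  { H of CompleteNormedModule R[i] H & CompleteNormedModule_isHilbert R H }.

Section DotNorm.
Context (C : numClosedFieldType) (U : lmodType C).
Variable op : {dot U for (Num.conj : C -> C)}.

Lemma dot_CS_sqrt u v : `|op u v| <= sqrtC (op u u) * sqrtC (op v v).
Proof.
rewrite -ler_sqr ?nnegrE ?mulr_ge0 ?sqrtC_ge0 ?dot_ge0// exprMn !sqrtCK.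
exact: dot_CS.
Qed.

Lemma dot_triangle u v :
  sqrtC (op (u + v) (u + v)) <= sqrtC (op u u) + sqrtC (op v v).
Proof.
rewrite -ler_sqr ?nnegrE ?addr_ge0 ?sqrtC_ge0 ?dot_ge0// sqrrD !sqrtCK.
rewrite dotDl !dotDr (dotC op v u).
have -> : op u u + op u v + (Num.conj (op u v) + op v v) =
  op u u + (op u v + Num.conj (op u v)) + op v v by rewrite !addrA.
rewrite lerD2r lerD2l.
have -> : op u v + Num.conj (op u v) = 'Re (op u v) *+ 2.
  by rewrite ReE -mulr_natr divfK// pnatr_eq0.
rewrite lerMn2r /=; apply: le_trans (dot_CS_sqrt u v).
exact: (leif_Re_Creal (op u v)).1.
Qed.

Lemma dot_normZ a u : sqrtC (op (a *: u) (a *: u)) = `|a| * sqrtC (op u u).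
Proof.
rewrite dotZl dotZr mulrA -normCK sqrtCM ?nnegrE ?exprn_ge0 ?dot_ge0//.
by rewrite sqrCK.
Qed.

Lemma dot_norm_eq0 u : sqrtC (op u u) = 0 -> u = 0.
Proof. by move/eqP; rewrite sqrtC_eq0 => /eqP/dot_eq0. Qed.

End DotNorm.

Section RealNorm.
Context (R : realType) (V : normedModType R[i]).
Implicit Types u v : V.

(* The norm of a normedModType R[i] takes its values in R[i]; rnorm is the same
   norm seen as a real number. *)
Definition rnorm v : R := re `|v|.

Lemma rnormE v : `|v| = (rnorm v)%:C.
Proof. by rewrite [RHS]RRe_real// ger0_real. Qed.

Lemma rnorm_ge0 v : 0 <= rnorm v.
Proof. by rewrite -ler0c -rnormE normr_ge0. Qed.

Lemma ler_rnormD u v : rnorm (u + v) <= rnorm u + rnorm v.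
Proof. by have := ler_normD u v; rewrite !rnormE -rmorphD lecR. Qed.

Lemma rnorm0 : rnorm (0 : V) = 0.
Proof. by rewrite /rnorm normr0. Qed.

Lemma rnorm_eq0 u : rnorm u = 0 -> u = 0.
Proof. by move=> u0; apply/normr0_eq0; rewrite rnormE u0. Qed.

Lemma rnormZ (a : R[i]) u : rnorm (a *: u) = re `|a| * rnorm u.
Proof.
apply: complexI; rewrite rmorphM /= -!rnormE normrZ; congr (_ * _).
Qed.

Lemma rnormB u v : rnorm (u - v) = rnorm (v - u).
Proof. by rewrite /rnorm distrC. Qed.

Lemma rnormD_sqr u v :
  rnorm (u + v) ^+ 2 <= 2 * rnorm u ^+ 2 + 2 * rnorm v ^+ 2.
Proof.
have h : rnorm (u + v) ^+ 2 <= (rnorm u + rnorm v) ^+ 2.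
  by rewrite ler_sqr ?nnegrE ?addr_ge0 ?rnorm_ge0 ?ler_rnormD.
apply: le_trans h _; rewrite -subr_ge0.
have -> : 2 * rnorm u ^+ 2 + 2 * rnorm v ^+ 2 - (rnorm u + rnorm v) ^+ 2 =
  (rnorm u - rnorm v) ^+ 2 by ring.
exact: sqr_ge0.
Qed.

End RealNorm.

Section L2.
Context (R : realType) (X : choiceType) (H : hilbertType R).
Implicit Types f g : X -> H.

Definition sqsummable f : bool := rsummable (fun x => rnorm (f x) ^+ 2).

Definition l2_pred : {pred X -> H} := sqsummable.

Record l2 := L2 { l2_val :> X -> H; l2_valP : l2_val \in l2_pred }.

HB.instance Definition _ := [isSub for l2_val].
HB.instance Definition _ := [Choice of l2 by <:].

Lemma l2_submod_closed : submod_closed l2_pred.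
Proof.
split=> [|a f g sf sg]; rewrite unfold_in /sqsummable.
  rewrite (_ : (fun _ => _) = (fun=> 0 * 0)); last first.
    by apply/funext => x; rewrite [X in rnorm X](_ : _ = 0)// rnorm0 expr0n mul0r.
  apply: rsummableZ; rewrite /rsummable /summable esum1// => x _ /=.
  by rewrite normr0.
rewrite /= in sf sg.
have := rsummableD (rsummableZ (2 * (re `|a|) ^+ 2) sf) (rsummableZ 2 sg).
apply: rsummable_le => x; rewrite ger0_norm ?sqr_ge0//.
apply: le_trans (ler_norm _); apply: le_trans (rnormD_sqr _ _) _.
by rewrite rnormZ exprMn mulrA.
Qed.

HB.instance Definition _ := GRing.isSubmodClosed.Build _ _ l2_pred
  l2_submod_closed.
HB.instance Definition _ := [SubChoice_isSubLmodule of l2 by <:].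

End L2.

Section L2Hilbert.
Context (R : realType) (X : choiceType) (H : hilbertType R).
Implicit Types f g h : l2 X H.

Lemma l2_eqP f g : f = g <-> forall x, f x = g x.
Proof. by split=> [->//|fg]; apply/val_inj/funext. Qed.

Lemma l2_sqsummable f : rsummable (fun x => rnorm (f x) ^+ 2).
Proof. exact: (l2_valP f). Qed.

Lemma inner_le (u v : H) : re `|inner u v| <= rnorm u * rnorm v.
Proof.
have := dot_CS_sqrt (@inner R H) u v.
rewrite !innerxx !sqrCK ?normr_ge0// !rnormE -rmorphM.
by rewrite lecE => /andP[].
Qed.

Lemma csummable_inner f g : csummable (fun x => inner (f x) (g x)).
Proof.
have := rsummableD (l2_sqsummable f) (l2_sqsummable g).
apply: rsummable_le => x; rewrite (ger0_norm (Re_norm_ge0 _)).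
apply: le_trans (ler_norm _); apply: le_trans (inner_le _ _) _ => /=.
have := sqr_ge0 (rnorm (f x) - rnorm (g x)).
have := mulr_ge0 (rnorm_ge0 (f x)) (rnorm_ge0 (g x)).
set a := rnorm (f x); set b := rnorm (g x); nra.
Qed.

Definition l2_inner f g : R[i] := csum (fun x => inner (f x) (g x)).

Lemma l2_innerDl h f g : l2_inner (f + g) h = l2_inner f h + l2_inner g h.
Proof.
rewrite /l2_inner -csumD; [|exact: csummable_inner|exact: csummable_inner].
by congr csum; apply/funext => x; rewrite -dotDl.
Qed.

Lemma l2_innerZl h (a : R[i]) f : l2_inner (a *: f) h = a * l2_inner f h.
Proof.
rewrite /l2_inner -csumZ; last exact: csummable_inner.
by congr csum; apply/funext => x; rewrite -dotZl.
Qed.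

Lemma l2_innerC f g : l2_inner f g = Num.conj (l2_inner g f).
Proof.
rewrite /l2_inner -csum_conj; last exact: csummable_inner.
by congr csum; apply/funext => x; rewrite -dotC.
Qed.

Let l2_zmodl h : zmod_morphism (l2_inner ^~ h).
Proof. by move=> f g /=; rewrite l2_innerDl -scaleN1r l2_innerZl mulN1r. Qed.

Let l2_zmodr h : zmod_morphism (l2_inner h).
Proof. by move=> f g; rewrite !(l2_innerC h) -rmorphB -l2_zmodl. Qed.

Let l2_scall h : scalable_for *%R (l2_inner ^~ h).
Proof. by move=> a f /=; rewrite l2_innerZl. Qed.

Let l2_scalr h : scalable_for (Num.conj \; *%R) (l2_inner h).
Proof. by move=> a f /=; rewrite !(l2_innerC h) l2_innerZl rmorphM. Qed.

HB.instance Definition _ := @isBilinear.Build R[i] (l2 X H) (l2 X H) R[i] *%R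
  (Num.conj \; *%R) l2_inner l2_zmodl l2_zmodr l2_scall l2_scalr.

Let l2_herm f g : l2_inner f g = (-1) ^+ false * Num.conj (l2_inner g f).
Proof. by rewrite expr0 mul1r -l2_innerC. Qed.

HB.instance Definition _ := @isHermitianSesquilinear.Build R[i] (l2 X H) false
  Num.conj l2_inner l2_herm.

Lemma l2_innerE f : l2_inner f f = (rsum (fun x => rnorm (f x) ^+ 2))%:C.
Proof.
have e x : inner (f x) (f x) = (rnorm (f x) ^+ 2)%:C.
  by rewrite innerxx rnormE rmorphXn.
rewrite /l2_inner /csum /=; congr (_ +i* _).
  by congr rsum; apply/funext => x; rewrite e.
rewrite (_ : (fun _ => _) = (fun x => 0 * rnorm (f x) ^+ 2)).
  by rewrite rsumZ ?mul0r//; exact: l2_sqsummable.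
by apply/funext => x; rewrite e mul0r.
Qed.

Lemma l2_pt_le f x : rnorm (f x) ^+ 2 <= rsum (fun x => rnorm (f x) ^+ 2).
Proof.
have := @rsum_fin_le _ _ _ _ (finite_set1 x) (l2_sqsummable f)
  (fun y => sqr_ge0 (rnorm (f y))).
by rewrite fsbig_set1.
Qed.

Let l2_gt0 f : f != 0 -> 0 < l2_inner f f.
Proof.
move=> f0; rewrite l2_innerE ltcR lt_neqAle eq_sym rsum_ge0 ?andbT.
- apply: contra_neq f0 => s0; apply/l2_eqP => x.
  apply: rnorm_eq0; apply/eqP; rewrite -sqrf_eq0 eq_le sqr_ge0 andbT -s0.
  exact: l2_pt_le.
- exact: l2_sqsummable.
- by move=> y; exact: sqr_ge0.
Qed.

HB.instance Definition _ := @isDotProduct.Build R[i] (l2 X H) l2_inner l2_gt0.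

Let l2_dot : {dot l2 X H for (Num.conj : R[i] -> R[i])} := l2_inner.

Definition l2_norm f : R[i] := sqrtC (l2_inner f f).

Let l2_normD f g : l2_norm (f + g) <= l2_norm f + l2_norm g.
Proof. exact: (dot_triangle l2_dot). Qed.

Let l2_normZ (a : R[i]) f : l2_norm (a *: f) = `|a| * l2_norm f.
Proof. exact: (dot_normZ l2_dot). Qed.

Let l2_norm_eq0 f : l2_norm f = 0 -> f = 0.
Proof. exact: (@dot_norm_eq0 _ _ l2_dot). Qed.

HB.instance Definition _ :=
  Lmodule_isNormed.Build R[i] (l2 X H) l2_normD l2_normZ l2_norm_eq0.

Lemma l2_innerxx f : l2_inner f f = `|f| ^+ 2.
Proof. by rewrite sqrtCK. Qed.

Lemma l2_rnormE f : rnorm f ^+ 2 = rsum (fun x => rnorm (f x) ^+ 2).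
Proof.
by apply: complexI; rewrite -l2_innerE l2_innerxx rnormE rmorphXn.
Qed.

Lemma l2_rnorm_pt_le f x : rnorm (f x) <= rnorm f.
Proof.
by rewrite -ler_sqr ?nnegrE ?rnorm_ge0// l2_rnormE l2_pt_le.
Qed.

End L2Hilbert.

Section L2Complete.
Context (R : realType) (X : choiceType) (H : hilbertType R).

Let complexE_gt0 (e : R[i]) : 0 < e -> exists2 r : R, 0 < r & e = r%:C.
Proof.
move=> e0; have er : (re e)%:C = e by rewrite RRe_real// gtr0_real.
by exists (re e) => //; rewrite -ltcR er.
Qed.

Let small_near (F : set_system (l2 X H)) (FF : ProperFilter F) (g : X -> H)
    (s : seq X) (d : R) : 0 < d ->
  (forall x (e : R), 0 < e -> F [set f | rnorm (f x - g x) < e]) ->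
  F [set f | forall x, x \in s -> rnorm (f x - g x) < d].
Proof.
move=> d0 Fg; elim: s => [|x s IH]; first exact: filterE.
apply: filterS2 IH (Fg x d d0) => f fs fx y.
by rewrite inE => /predU1P[->|/fs].
Qed.

Lemma l2_complete (F : set_system (l2 X H)) : ProperFilter F ->
  cauchy F -> cvg F.
Proof.
move=> FF /cauchyP Fc.
have {}Fc (e : R) : 0 < e ->
    exists f0 : l2 X H, F [set f | rnorm (f0 - f) < e].
  move=> e0; have /Fc[f0 Ff0] : 0 < e%:C by rewrite ltcR.
  exists f0; apply: filterS Ff0 => f.
  by rewrite -ball_normE /= rnormE ltcR.
have Fx x : cvg ((fun f : l2 X H => f x) @ F).
  apply: cauchy_cvg; apply/cauchyP => e /complexE_gt0[r r0 ->].
  have [f0 Ff0] := Fc r r0; exists (f0 x).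
  suff : F [set f | ball (f0 x) r%:C (f x)] by [].
  apply: filterS Ff0 => f /= fr.
  rewrite -ball_normE /= rnormE ltcR.
  have -> : f0 x - f x = (f0 - f) x by [].
  by apply: le_lt_trans fr; exact: l2_rnorm_pt_le.
pose g x : H := lim ((fun f : l2 X H => f x) @ F).
have Fg x (e : R) : 0 < e -> F [set f | rnorm (f x - g x) < e].
  move=> e0; have e0' : 0 < e%:C by rewrite ltcR.
  have /cvgrPdist_lt/(_ _ e0') := Fx x.
  by apply: filterS => f /=; rewrite rnormE ltcR rnormB.
have bnd (e : R) (f0 : l2 X H) : 0 < e -> F [set f | rnorm (f0 - f) < e] ->
    rsummable (fun x => rnorm (f0 x - g x) ^+ 2) /\
    rsum (fun x => rnorm (f0 x - g x) ^+ 2) <= (2 * e) ^+ 2.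
  move=> e0 Ff0; apply: rsummable_bnd => [x|A fA]; first exact: sqr_ge0.
  rewrite fsbig_finite//=; set s := fset_set A.
  pose d := e / Num.sqrt ((size s).+1%:R).
  have d0 : 0 < d by rewrite divr_gt0// sqrtr_gt0 ltr0n.
  have [f [/= ff0 fg]] := filter_ex (filterI Ff0 (small_near FF s d0 Fg)).
  apply: (@le_trans _ _ (\sum_(x <- s)
      (2 * rnorm ((f0 - f) x) ^+ 2 + 2 * (e ^+ 2 / (size s).+1%:R)))).
    rewrite big_seq [leRHS]big_seq; apply: ler_sum => x xs.
    have -> : f0 x - g x = (f0 - f) x + (f x - g x) by rewrite addrA subrK.
    apply: le_trans (rnormD_sqr _ _) _; rewrite lerD2l ler_pM2l//.
    have -> : e ^+ 2 / (size s).+1%:R = d ^+ 2.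
      by rewrite /d expr_div_n sqr_sqrtr.
    by rewrite ler_sqr ?nnegrE ?rnorm_ge0 ?(ltW d0)// ltW// fg.
  rewrite big_split /= exprMn -mulr_sumr.
  have -> : 2 ^+ 2 * e ^+ 2 = 2 * e ^+ 2 + 2 * e ^+ 2 by ring.
  apply: lerD.
    rewrite ler_pM2l//; apply: (@le_trans _ _ (rnorm (f0 - f) ^+ 2)).
      rewrite l2_rnormE.
      have := rsum_fin_le fA (l2_sqsummable (f0 - f))
        (fun y => sqr_ge0 (rnorm ((f0 - f) y))).
      by rewrite fsbig_finite.
    by rewrite ler_sqr ?nnegrE ?rnorm_ge0 ?(ltW e0)// ltW.
  rewrite -mulr_sumr ler_pM2l// big_const_seq count_predT iter_addr addr0.
  rewrite -[leLHS]mulr_natr mulrAC ler_pdivrMr ?ltr0n// ler_wpM2l ?sqr_ge0//.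
  by rewrite ler_nat.
have [f1 /(bnd _ _ ltr01)[sg _]] := Fc 1 ltr01.
pose G : l2 X H := f1 - L2 (sg : (fun x => f1 x - g x) \in @l2_pred R X H).
have GE x : G x = g x.
  by have -> : G x = f1 x - (f1 x - g x) by []; rewrite subKr.
apply/cvg_ex; exists G; apply/cvgrPdist_lt => e /complexE_gt0[r r0 ->].
have r40 : 0 < r / 4 by rewrite divr_gt0.
have [f0 Ff0] := Fc (r / 4) r40.
have [_ b] := bnd _ _ r40 Ff0.
apply: filterS Ff0 => f /= ff0; rewrite rnormE ltcR.
have -> : G - f = (G - f0) + (f0 - f) by rewrite addrA subrK.
apply: le_lt_trans (ler_rnormD _ _) _.
have : rnorm (G - f0) <= 2 * (r / 4).
  have r0' : 0 <= 2 * (r / 4) by lra.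
  rewrite rnormB -ler_sqr ?nnegrE ?rnorm_ge0//.
  rewrite l2_rnormE; apply: le_trans b; rewrite le_eqVlt; apply/orP; left.
  by apply/eqP; congr rsum; apply/funext => x; rewrite [X in rnorm X]/(f0 x - G x) GE.
move: ff0; lra.
Qed.

HB.instance Definition _ := Uniform_isComplete.Build (l2 X H) l2_complete.

HB.instance Definition _ := CompleteNormedModule_isHilbert.Build R (l2 X H)
  (@l2_innerxx R X H).

End L2Complete.

Section L2Delta.
Context (R : realType) (X : choiceType) (H : hilbertType R).

Lemma l2_delta_subproof (x : X) (v : H) :
  (fun y => if y == x then v else 0) \in @l2_pred R X H.
Proof.
rewrite unfold_in /sqsummable /rsummable /summable.
rewrite (@eq_esum _ _ _ _
    (fun y => if y \in [set x] then (`|rnorm v ^+ 2|)%:E else 0%E)); last first.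
  move=> y _ /=; have [->|yx] := eqVneq y x; first by rewrite mem_set.
  by rewrite memNset/=; [rewrite rnorm0 expr0n/= normr0|exact/eqP].
by rewrite -(esum_mkcond [set x]) esum_set1 ?ltry// lee_fin.
Qed.

Definition l2_delta (x : X) (v : H) : l2 X H := L2 (l2_delta_subproof x v).

(* The matrix coefficient T_{xy}: row x, column y. *)
Definition entry (T : l2 X H -> l2 X H) (x y : X) : H -> H :=
  fun v => T (l2_delta y v) x.

End L2Delta.

(* Operators on E are plain functions E -> E; functional extensionality makes
   Leibniz equality of such functions equality of operators. *)
Section Operators.
Context (R : realType) (E : hilbertType R).
Implicit Types (T S : E -> E) (A : set (E -> E)).

Definition bounded_op : set (E -> E) :=
  [set T | linear T /\ exists M : R, forall v, rnorm (T v) <= M * rnorm v].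

Definition opnorm T : R :=
  inf [set M : R | 0 <= M /\ forall v, rnorm (T v) <= M * rnorm v].

Definition is_adjoint T S := forall u v, inner (T u) v = inner u (S v).

Definition compact_op T := compact (closure (T @` [set v | rnorm v <= 1])).

(* The range of T is spanned by N vectors. *)
Definition rank_le T (N : nat) :=
  exists b : 'I_N -> E, forall v, exists c : 'I_N -> R[i],
    T v = \sum_(i < N) c i *: b i.

Definition norm_closure A : set (E -> E) :=
  [set T | bounded_op T /\
    forall e : R, 0 < e -> exists2 S, A S & opnorm (T \- S) < e].

(* Not required to be unital. Adjoints of bounded operators exist and are
   unique, so the last clause says that T^* belongs to A. *)
Definition star_subalgebra A :=
  [/\ A `<=` bounded_op,
      A (fun=> 0),
      (forall S T, A S -> A T -> A (S \+ T)),
      (forall (a : R[i]) T, A T -> A (a \*: T)) &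
      (forall S T, A S -> A T -> A (S \o T)) /\
      (forall T, A T -> exists2 S, A S & is_adjoint T S)].

Definition cstar_subalgebra A := star_subalgebra A /\ norm_closure A `<=` A.

End Operators.

Definition star_isomorphism (R : realType) (E F : hilbertType R)
    (A : set (E -> E)) (B : set (F -> F)) (phi : (E -> E) -> (F -> F)) :=
  [/\ set_bij A B phi,
      (forall S T, A S -> A T -> phi (S \+ T) = phi S \+ phi T),
      (forall (a : R[i]) T, A T -> phi (a \*: T) = a \*: phi T),
      (forall S T, A S -> A T -> phi (S \o T) = phi S \o phi T) &
      (forall S T, A S -> A T -> is_adjoint T S ->
         is_adjoint (phi T) (phi S))].

Definition separable (T : topologicalType) :=
  exists D : set T, countable D /\ dense D.

Section RoeType.
Context (R : realType) (X : metricType R) (H : hilbertType R).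
Implicit Types (T : l2 X H -> l2 X H) (A : set (l2 X H -> l2 X H)).

Definition finite_propagation T :=
  exists2 S : R, 0 < S &
    forall x y : X, S <= mdist x y -> forall v, entry T x y v = 0.

Definition locally_compact_op T := forall x y : X, compact_op (entry T x y).

Definition algebraic_roe_type A :=
  [/\ star_subalgebra A,
      (forall T, A T -> locally_compact_op T /\ finite_propagation T) &
      (forall T, bounded_op T -> finite_propagation T ->
         (exists N : nat, forall x y : X, rank_le (entry T x y) N) -> A T)].

Definition roe_type_algebra A :=
  cstar_subalgebra A /\
  exists2 A0, algebraic_roe_type A0 & A = norm_closure A0.

End RoeType.

Section CoarseGeometry.
Context (R : realType).

Definition bounded_geometry (X : metricType R) :=
  forall r : R, 0 <= r -> exists N : nat,
    forall x : X, ([set y | mdist x y <= r] #<= `I_N)%card.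

Definition uniformly_expansive (X Y : metricType R) (f : X -> Y) :=
  forall r : R, 0 < r -> exists2 s : R, 0 < s &
    forall x1 x2, mdist x1 x2 <= r -> mdist (f x1) (f x2) <= s.

Definition close_maps (X Y : metricType R) (f g : X -> Y) :=
  exists2 c : R, 0 < c & forall x, mdist (f x) (g x) <= c.

Definition coarsely_equivalent (X Y : metricType R) :=
  exists (f : X -> Y) (g : Y -> X),
    [/\ uniformly_expansive f, uniformly_expansive g,
        close_maps (f \o g) id & close_maps (g \o f) id].

(* The quotient is only meaningful when A x and A x' meet: in MathComp division
   by zero gives zero, hence the explicit nonemptiness of the intersection. *)
Definition property_A (X : metricType R) :=
  forall r e : R, 0 < r -> 0 < e -> exists A : X -> {fset X * nat},
    [/\ (forall x, (x, 1%N) \in A x),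
        (forall x x', mdist x x' <= r ->
           (A x `&` A x')%fset != fset0 /\
           (#|` ((A x `\` A x') `|` (A x' `\` A x))%fset|)%:R /
             (#|` (A x `&` A x')%fset|)%:R < e :> R) &
        exists2 s : R, 0 < s & forall x y z m n,
          (y, m) \in A x -> (z, n) \in A x -> mdist y z <= s].

End CoarseGeometry.

(* Main.v *)
Require Import Defs.
From mathcomp Require Import all_boot all_order all_algebra finmap complex.
From mathcomp Require Import boolp classical_sets functions cardinality fsbigop.
From mathcomp Require Import reals ereal topology normedtype numfun esum ring lra.

Set Implicit Arguments.
Unset Strict Implicit.
Unset Printing Implicit Defensive.
Import Order.TTheory GRing.Theory Num.Theory.
Import numFieldNormedType.Exports.
Local Open Scope classical_set_scope.
Local Open Scope complex_scope.
Local Open Scope ring_scope.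

Local Notation re := complex.Re.

(* The isomorphism is implemented by a unitary U, because the Roe-type algebras
   contain all rank one operators. Fix a unit vector h and let f_x be the image
   under U of delta_x h. The main point is that the f_x are uniformly concentrated
   on bounded subsets of Y; sending x to the location of f_x is then a coarse
   equivalence, since a displacement operator with matrix coefficient one between
   two sites is carried by U to a limit of finite propagation operators, which
   cannot connect far apart regions of Y.

   Suppose concentration fails. Local compactness makes f_x(y) tend to zero in x
   for each y, so there are x_n with f_{x_n} ever less concentrated and pairwise
   almost disjointly supported. Conjugation by U sends the projection on the span
   of the delta_{x_n} h to an operator Q near one of finite propagation, and
   property A gives a slowly varying partition of unity (xi_z) on Y, with supports
   of bounded diameter, for which sum_z <Q xi_z f, xi_z f> is almost <Q f, f> = 1
   for f = f_{x_n}. As the supports are almost disjoint, this sum is almost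
   sum_z |<xi_z f, f>|^2, which is at most the largest mass of f on the support of
   some xi_z. Hence f is concentrated after all. *)

(** * Complex Hilbert spaces and unconditional sums *)

Section ModulusAndRealPart.
Context (R : realType).
Implicit Types z w : R[i].

(** The norm of [R[i]] takes its values in [R[i]]; this real copy allows ordered-field arguments
    over [R]. *)
Definition cmod z : R := re `|z|.

Lemma cmodE z : `|z| = (cmod z)%:C.
Proof. by rewrite [RHS]RRe_real// ger0_real. Qed.

Lemma cmod_ge0 z : 0 <= cmod z. Proof. exact: Re_norm_ge0. Qed.

Lemma cmodM z w : cmod (z * w) = cmod z * cmod w.
Proof. by apply: complexI; rewrite rmorphM /= -!cmodE normrM. Qed.

Lemma cmodD z w : cmod (z + w) <= cmod z + cmod w.
Proof. by rewrite -lecR rmorphD /= -!cmodE ler_normD. Qed.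

Lemma cmodJ z : cmod (Num.conj z) = cmod z.
Proof. by rewrite /cmod norm_conjC. Qed.

Lemma cmodR (a : R) : cmod a%:C = `|a|.
Proof. by rewrite /cmod normc_def /= expr0n addr0 sqrtr_sqr. Qed.

Lemma cmod0 : cmod 0 = 0. Proof. by rewrite /cmod normr0. Qed.

Lemma cmod_sum (I : Type) (s : seq I) (F : I -> R[i]) :
  cmod (\sum_(i <- s) F i) <= \sum_(i <- s) cmod (F i).
Proof.
elim: s => [|i s IH]; first by rewrite !big_nil cmod0.
by rewrite !big_cons; apply: le_trans (cmodD _ _) _; rewrite lerD2l.
Qed.

Lemma re_le_cmod z : re z <= cmod z.
Proof. exact: le_trans (ler_norm _) (Re_le_norm z). Qed.

Lemma norm_re_le_cmod z : `|re z| <= cmod z.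
Proof. exact: Re_le_norm. Qed.

Lemma reD z w : re (z + w) = re z + re w.
Proof. by case: z w => [? ?] []. Qed.

Lemma reN z : re (- z) = - re z.
Proof. by case: z. Qed.

Lemma reZ (a : R) z : re (a%:C * z) = a * re z.
Proof. by case: z => x y /=; rewrite mul0r subr0. Qed.

Lemma re_sum (I : Type) (s : seq I) (F : I -> R[i]) :
  re (\sum_(i <- s) F i) = \sum_(i <- s) re (F i).
Proof.
elim: s => [|i s IH]; first by rewrite !big_nil.
by rewrite !big_cons reD IH.
Qed.

Lemma conjR (a : R) : Num.conj (a%:C : R[i]) = a%:C.
Proof. by apply/CrealP; rewrite complex_real. Qed.

Lemma conj_mul_self z : z * Num.conj z = (cmod z ^+ 2)%:C.
Proof. by rewrite -normCK cmodE rmorphXn. Qed.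

End ModulusAndRealPart.

Section HilbertSpace.
Context (R : realType) (E : hilbertType R).
Implicit Types (u v w : E) (a : R[i]).

Lemma innerC u v : inner u v = Num.conj (inner v u).
Proof. exact: (dotC (@inner R E)). Qed.
Lemma innerDl u v w : inner (u + v) w = inner u w + inner v w.
Proof. exact: (dotDl (@inner R E)). Qed.
Lemma innerDr u v w : inner w (u + v) = inner w u + inner w v.
Proof. exact: (dotDr (@inner R E)). Qed.
Lemma innerBl u v w : inner (u - v) w = inner u w - inner v w.
Proof. exact: (dotBl (@inner R E)). Qed.
Lemma innerBr u v w : inner w (u - v) = inner w u - inner w v.
Proof. exact: (dotBr (@inner R E)). Qed.
Lemma innerZl a u v : inner (a *: u) v = a * inner u v.
Proof. exact: (dotZl (@inner R E)). Qed.
Lemma innerZr a u v : inner u (a *: v) = Num.conj a * inner u v.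
Proof. exact: (dotZr (@inner R E)). Qed.
Lemma inner0l u : inner 0 u = 0. Proof. exact: (dot0l (@inner R E)). Qed.
Lemma inner0r u : inner u 0 = 0. Proof. exact: (dot0r (@inner R E)). Qed.

Lemma inner_suml (I : Type) (s : seq I) (F : I -> E) v :
  inner (\sum_(i <- s) F i) v = \sum_(i <- s) inner (F i) v.
Proof.
elim: s => [|i s IH]; first by rewrite !big_nil inner0l.
by rewrite !big_cons innerDl IH.
Qed.

Lemma inner_sumr (I : Type) (s : seq I) (F : I -> E) v :
  inner v (\sum_(i <- s) F i) = \sum_(i <- s) inner v (F i).
Proof.
elim: s => [|i s IH]; first by rewrite !big_nil inner0r.
by rewrite !big_cons innerDr IH.
Qed.

Lemma inner_self u : inner u u = (rnorm u ^+ 2)%:C.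
Proof. by rewrite innerxx rnormE rmorphXn. Qed.

Lemma re_inner_self u : re (inner u u) = rnorm u ^+ 2.
Proof. by rewrite inner_self. Qed.

Lemma cmod_inner_le u v : cmod (inner u v) <= rnorm u * rnorm v.
Proof. exact: inner_le. Qed.

Lemma re_inner_le u v : re (inner u v) <= rnorm u * rnorm v.
Proof. exact: le_trans (re_le_cmod _) (cmod_inner_le _ _). Qed.

Lemma re_inner_ge u v : - (rnorm u * rnorm v) <= re (inner u v).
Proof.
have := le_trans (Re_le_norm (inner u v)) (cmod_inner_le u v).
by rewrite ler_norml => /andP[].
Qed.

Lemma rnormN u : rnorm (- u) = rnorm u.
Proof. by rewrite /rnorm normrN. Qed.

Lemma rnormZr (c : R) u : rnorm (c%:C *: u) = `|c| * rnorm u.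
Proof. by rewrite rnormZ -/(cmod _) cmodR. Qed.

Lemma rnorm_inj u v : rnorm (u - v) = 0 -> u = v.
Proof. by move/rnorm_eq0/eqP; rewrite subr_eq0 => /eqP. Qed.

Lemma rnorm_gt0 u : u != 0 -> 0 < rnorm u.
Proof.
move=> u0; rewrite lt_neqAle rnorm_ge0 andbT eq_sym.
by apply: contra_neq u0; exact: rnorm_eq0.
Qed.

Lemma rnorm_normalize u : u != 0 -> rnorm ((rnorm u)^-1%:C *: u) = 1.
Proof.
move=> /rnorm_gt0 u0; rewrite rnormZr ger0_norm ?invr_ge0 ?rnorm_ge0//.
by rewrite mulVf// gt_eqF.
Qed.

Lemma rnorm_sum_le (I : Type) (s : seq I) (F : I -> E) :
  rnorm (\sum_(i <- s) F i) <= \sum_(i <- s) rnorm (F i).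
Proof.
elim: s => [|i s IH]; first by rewrite !big_nil rnorm0.
by rewrite !big_cons; apply: le_trans (ler_rnormD _ _) _; rewrite lerD2l.
Qed.

Lemma rnorm_le_sqr u (c : R) : 0 <= c -> (rnorm u <= c) = (rnorm u ^+ 2 <= c ^+ 2).
Proof. by move=> c0; rewrite ler_sqr ?nnegrE ?rnorm_ge0. Qed.

End HilbertSpace.

Section LinearMaps.
Context (R : realType) (E F : hilbertType R) (T : E -> F).
Hypothesis linT : linear T.

Lemma lin0 : T 0 = 0.
Proof. by have := linT (-1) 0 0; rewrite !scaleN1r !addNr. Qed.
Lemma linZ a u : T (a *: u) = a *: T u.
Proof. by have := linT a u 0; rewrite !addr0 lin0 addr0. Qed.
Lemma linD u v : T (u + v) = T u + T v.
Proof. by have := linT 1 u v; rewrite !scale1r. Qed.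
Lemma linB u v : T (u - v) = T u - T v.
Proof. by rewrite linD -scaleN1r linZ scaleN1r. Qed.
Lemma lin_sum (I : Type) (s : seq I) (G : I -> E) :
  T (\sum_(i <- s) G i) = \sum_(i <- s) T (G i).
Proof.
elim: s => [|i s IH]; first by rewrite !big_nil lin0.
by rewrite !big_cons linD IH.
Qed.

End LinearMaps.

Section FiniteSums.
Context (R : realType) (X : choiceType).
Implicit Types (f : X -> R) (A : {fset X}).

Lemma fsbig_fset (A : {fset X}) f :
  \sum_(x \in [set` A]) f x = \sum_(x <- A) f x.
Proof. by rewrite fsbig_finite//= set_fsetK. Qed.

Lemma rsum_fset_le f A : rsummable f -> (forall x, 0 <= f x) ->
  \sum_(x <- A) f x <= rsum f.
Proof. by move=> sf f0; rewrite -fsbig_fset rsum_fin_le. Qed.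

Lemma rsummable_fset_bnd f (M : R) : (forall x, 0 <= f x) ->
  (forall A, \sum_(x <- A) f x <= M) -> rsummable f /\ rsum f <= M.
Proof.
by move=> f0 bf; apply: rsummable_bnd => // A fA; rewrite fsbig_finite//= bf.
Qed.

Lemma sum_indicator_le A (B : {fset X}) (P : pred X) :
  (forall x, P x -> x \in B) -> \sum_(x <- A) (P x)%:R <= (#|` B|)%:R :> R.
Proof.
move=> PB; rewrite -natr_sum ler_nat.
rewrite (eq_bigr (fun x => if P x then 1 else 0)%N) => [|x _]; last by case: (P x).
rewrite -big_mkcond sum1_count -size_filter uniq_leq_size//.
  by rewrite filter_uniq// fset_uniq.
by move=> x; rewrite mem_filter => /andP[/PB].
Qed.

Lemma rsum_approx f (e : R) : rsummable f -> (forall x, 0 <= f x) -> 0 < e ->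
  exists A, rsum f - e <= \sum_(x <- A) f x.
Proof.
move=> sf f0 e0; apply: contrapT => /forallNP h.
have [] : rsummable f /\ rsum f <= rsum f - e.
  apply: rsummable_fset_bnd => // A.
  by have /negP := h A; rewrite -ltNge => /ltW.
by move=> _; rewrite lerBrDr gerDl leNgt e0.
Qed.

Lemma rsum_single f x : (forall y, y != x -> f y = 0) ->
  rsummable f /\ rsum f = f x.
Proof.
move=> fx.
have ind : rsummable (fun y => (y == x)%:R : R) /\
    rsum (fun y => (y == x)%:R : R) <= 1.
  apply: rsummable_fset_bnd => [y|A]; first by rewrite ler0n.
  have [xA|xA] := boolP (x \in A).
    rewrite (big_fsetD1 x)//= eqxx big_seq big1 ?addr0// => y.
    by rewrite !inE => /andP[/negbTE->].
  rewrite big_seq big1 ?ler01// => y yA.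
  by case: eqVneq yA xA => // -> ->.
have ind1 : rsum (fun y => (y == x)%:R : R) = 1.
  apply/eqP; rewrite eq_le ind.2/=.
  have := @rsum_fset_le _ [fset x]%fset ind.1 (fun y => ler0n _ _).
  by rewrite big_seq_fset1 eqxx.
have -> : f = (fun y => f x * (y == x)%:R).
  apply/funext => y; have [->|yx] := eqVneq y x; first by rewrite mulr1.
  by rewrite fx// mulr0.
split; first exact: (rsummableZ _ ind.1).
by rewrite (rsumZ _ ind.1) ind1 eqxx mulr1.
Qed.

End FiniteSums.

Lemma csum_single (R : realType) (X : choiceType) (f : X -> R[i]) x :
  (forall y, y != x -> f y = 0) -> csum f = f x.
Proof.
move=> fx; rewrite /csum.
rewrite (rsum_single (x := x) _).2; last by move=> y yx; rewrite fx.
rewrite (rsum_single (x := x) _).2; last by move=> y yx; rewrite fx.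
by case: (f x).
Qed.

(** * Finitely supported functions and matrix coefficients *)

Section L2Functions.
Context (R : realType) (X : choiceType) (H : hilbertType R).
Implicit Types (f g : l2 X H) (A : {fset X}) (B : set X).

Lemma l2_addE f g x : (f + g) x = f x + g x. Proof. by []. Qed.
Lemma l2_subE f g x : (f - g) x = f x - g x. Proof. by []. Qed.
Lemma l2_scaleE (a : R[i]) f x : (a *: f) x = a *: f x. Proof. by []. Qed.
Lemma l2_0E x : (0 : l2 X H) x = 0. Proof. by []. Qed.

Lemma l2_sumE (I : Type) (s : seq I) (F : I -> l2 X H) x :
  (\sum_(i <- s) F i) x = \sum_(i <- s) F i x.
Proof.
elim: s => [|i s IH]; first by rewrite !big_nil l2_0E.
by rewrite !big_cons l2_addE IH.
Qed.

Lemma l2_deltaE (x : X) (v : H) y : l2_delta x v y = if y == x then v else 0.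
Proof. by []. Qed.

Lemma inner_delta (x : X) (v : H) f : inner (l2_delta x v) f = inner v (f x).
Proof.
rewrite -[LHS]/(csum (fun y => inner (l2_delta x v y) (f y))).
rewrite (csum_single (x := x)); first by rewrite l2_deltaE eqxx.
by move=> y /negbTE yx; rewrite l2_deltaE yx inner0l.
Qed.

Lemma rnorm_delta (x : X) (v : H) : rnorm (l2_delta x v) = rnorm v.
Proof.
apply/eqP; rewrite -(@eqrXn2 _ 2)// ?rnorm_ge0//.
by rewrite -!re_inner_self inner_delta l2_deltaE eqxx.
Qed.

Lemma l2_sum_sqr_le f A : \sum_(x <- A) rnorm (f x) ^+ 2 <= rnorm f ^+ 2.
Proof.
rewrite l2_rnormE; apply: rsum_fset_le => [|x]; last exact: sqr_ge0.
exact: l2_sqsummable.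
Qed.

Lemma restr_subproof B f :
  (fun x => if x \in B then f x else 0) \in @l2_pred R X H.
Proof.
rewrite unfold_in; apply: rsummable_le (l2_sqsummable f) => x.
rewrite !ger0_norm ?sqr_ge0//; case: ifP => // _.
by rewrite rnorm0 expr0n sqr_ge0.
Qed.

Definition restr B f : l2 X H := L2 (restr_subproof B f).

Lemma restrE B f x : restr B f x = if x \in B then f x else 0.
Proof. by []. Qed.

Lemma rnorm_restrC B f :
  rnorm f ^+ 2 = rnorm (restr B f) ^+ 2 + rnorm (f - restr B f) ^+ 2.
Proof.
rewrite !l2_rnormE -rsumD; try exact: l2_sqsummable.
congr rsum; apply/funext => x.
rewrite -[RHS]/(rnorm (restr B f x) ^+ 2 + rnorm (f x - restr B f x) ^+ 2) restrE.
by case: ifP => _; rewrite ?subrr ?subr0 rnorm0 expr0n ?addr0 ?add0r.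
Qed.

Lemma rnorm_restr_le B f : rnorm (restr B f) <= rnorm f.
Proof.
rewrite rnorm_le_sqr ?rnorm_ge0// [leRHS](rnorm_restrC B f) lerDl.
exact: sqr_ge0.
Qed.

Lemma sum_delta_mem A f x : x \in A -> \sum_(y <- A) l2_delta y (f y) x = f x.
Proof.
move=> xA; have z : \sum_(y <- (A `\ x)%fset) l2_delta y (f y) x = 0.
  rewrite big_seq big1// => y.
  by rewrite !inE l2_deltaE eq_sym => /andP[/negbTE->].
by rewrite (big_fsetD1 x xA) z l2_deltaE eqxx; exact: addr0.
Qed.

Lemma restr_fsetE A f :
  restr [set` A] f = \sum_(x <- A) l2_delta x (f x).
Proof.
apply/l2_eqP => x; rewrite l2_sumE restrE.
rewrite (_ : (x \in [set` A]) = (x \in A)); last first.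
  by apply/idP/idP; rewrite inE.
case: ifPn => xA; first by rewrite sum_delta_mem.
rewrite big_seq big1// => y yA; rewrite l2_deltaE.
by case: eqVneq yA xA => // -> ->.
Qed.

Lemma rnorm_restr_fset A f :
  rnorm (restr [set` A] f) ^+ 2 = \sum_(x <- A) rnorm (f x) ^+ 2.
Proof.
rewrite -re_inner_self restr_fsetE inner_suml re_sum.
apply: eq_big_seq => x xA; rewrite inner_delta l2_sumE.
by rewrite sum_delta_mem ?re_inner_self.
Qed.

Lemma restr_approx f (e : R) : 0 < e ->
  exists A, rnorm (f - restr [set` A] f) <= e.
Proof.
move=> e0; have e20 : 0 < e ^+ 2 by rewrite exprn_gt0.
have [A hA] := rsum_approx (l2_sqsummable f) (fun x => sqr_ge0 _) e20.
exists A; rewrite rnorm_le_sqr ?(ltW e0)//.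
have := rnorm_restrC [set` A] f; rewrite rnorm_restr_fset.
by move: hA; rewrite -l2_rnormE; lra.
Qed.

(** Outside a finite set carrying [f] up to norm [c / 2], no value can reach [c]. *)
Lemma l2_ge_finite f (c : R) : 0 < c -> finite_set [set x | c <= rnorm (f x)].
Proof.
move=> c0; have c2 : 0 < c / 2 by rewrite divr_gt0.
have [A hA] := restr_approx f c2.
apply: (sub_finite_set (B := [set` A])) => // x /= cx.
apply: contrapT => /negP xA.
have := le_trans (l2_rnorm_pt_le _ x) hA; rewrite l2_subE restrE.
have -> : (x \in [set` A]) = false by apply/negP; rewrite inE; exact/negP.
by rewrite subr0; lra.
Qed.

Lemma inner_restr B f g : inner (restr B f) g = inner (restr B f) (restr B g).
Proof.
rewrite -[LHS]/(csum (fun x => inner (restr B f x) (g x))).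
rewrite -[RHS]/(csum (fun x => inner (restr B f x) (restr B g x))).
congr csum; apply/funext => x; rewrite !restrE.
by case: ifP => // _; rewrite !inner0l.
Qed.

End L2Functions.

Section Entries.
Context (R : realType) (X : choiceType) (H : hilbertType R).
Implicit Types u : l2 X H.
Variables (S : l2 X H -> l2 X H) (M : R).
Hypothesis linS : linear S.
Hypothesis bndS : forall u, rnorm (S u) <= M * rnorm u.

Lemma op_value_fset (A : {fset X}) u x :
  S (restr [set` A] u) x = \sum_(y <- A) entry S x y (u y).
Proof. by rewrite restr_fsetE (lin_sum linS) l2_sumE. Qed.

(* Density of finitely supported functions turns matrix coefficients into values. *)
Lemma op_value_eq0 u x :
  (forall y, entry S x y (u y) = 0) -> S u x = 0.
Proof.
move=> Su; apply: rnorm_eq0; apply/eqP; rewrite eq_le rnorm_ge0 andbT.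
apply/ler_addgt0Pr => e e0; rewrite add0r.
have M0 : 0 < `|M| + 1 by rewrite ltr_wpDl.
have [A hA] := restr_approx u (divr_gt0 e0 M0).
have : S (u - restr [set` A] u) x = S u x.
  by rewrite (linB linS) l2_subE op_value_fset big1 ?subr0.
move=> <-; apply: le_trans (l2_rnorm_pt_le _ x) _.
apply: le_trans (bndS _) _; apply: le_trans (ler_wpM2r (rnorm_ge0 _) (ler_norm M)) _.
apply: le_trans (ler_wpM2l (normr_ge0 M) hA) _.
rewrite mulrCA ger_pMr// ler_pdivrMr//; lra.
Qed.

End Entries.

(** * Displacement operators *)

Section BoundedGeometry.
Context (R : realType) (X : metricType R).
Hypothesis bgX : bounded_geometry X.

Lemma bounded_geometry_fset (r : R) : 0 <= r ->
  exists N : nat, exists b : X -> {fset X},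
    (forall x y, (y \in b x) = (mdist x y <= r)) /\ forall x, (#|` b x| <= N)%N.
Proof.
move=> r0; have [N hN] := bgX r0; exists N.
have fin (x : X) : finite_set [set y | mdist x y <= r].
  by apply/finite_set_leP; exists N; exact: hN.
exists (fun x => fset_set [set y | mdist x y <= r]); split=> [x y|x].
  by rewrite in_fset_set ?inE//; apply/idP/idP; rewrite inE.
by rewrite geq_card_fset_set.
Qed.

(** By bounded geometry [t] is uniformly finite-to-one: every point sent to [z] lies in the [r]-ball
    about [z], so [a z] is counted at most [N] times. *)
Lemma sum_displaced_le (t : X -> X) (r : R) : 0 <= r ->
  (forall x, mdist x (t x) <= r) ->
  exists N : nat, forall (a : X -> R) (A : {fset X}) (M : R),
    (forall x, 0 <= a x) -> (forall B : {fset X}, \sum_(x <- B) a x <= M) ->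
    \sum_(x <- A) a (t x) <= N%:R * M.
Proof.
move=> r0 tr; have [N [b [bE bN]]] := bounded_geometry_fset r0.
exists N => a A M a0 aM.
apply: (@le_trans _ _ (\sum_(z <- [fset t x | x in A]%fset) N%:R * a z)); last first.
  by rewrite -mulr_sumr ler_wpM2l.
have -> : \sum_(x <- A) a (t x) =
    \sum_(x <- A) \sum_(z <- [fset t x | x in A]%fset) (t x == z)%:R * a z.
  apply: eq_big_seq => x xA.
  rewrite (big_fsetD1 (t x)) /=; last by apply: in_imfset.
  rewrite eqxx mul1r big_seq big1 ?addr0// => z.
  by rewrite !inE eq_sym => /andP[/negbTE->]; rewrite mul0r.
rewrite exchange_big /=; apply: ler_sum => z _.
rewrite -mulr_suml ler_wpM2r//.
apply: le_trans (sum_indicator_le R _ (B := b z) (P := fun x => t x == z) _) _; last by rewrite ler_nat.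
by move=> x /eqP<-; rewrite bE metric_sym.
Qed.

Definition rank_one_entries (H : hilbertType R) (T : l2 X H -> l2 X H) :=
  [/\ bounded_op T, finite_propagation T & forall x y, rank_le (entry T x y) 1].

(** The only nonzero entry in row [x] is at column [t x]; boundedness holds because few rows share a
    column. With [t] the identity and [v = w] of norms 0 or 1 this is a projection onto a span of
    sites; a general [t] links each site to a nearby one. *)
Lemma displacement_op (H : hilbertType R) (t : X -> X) (v w : X -> H) (r : R) :
  0 <= r -> (forall x, mdist x (t x) <= r) ->
  (forall x, rnorm (v x) <= 1) -> (forall x, rnorm (w x) <= 1) ->
  exists2 T : l2 X H -> l2 X H, rank_one_entries T &
    forall g x, T g x = inner (g (t x)) (v x) *: w x.
Proof.
move=> r0 tr v1 w1; have [N hN] := sum_displaced_le r0 tr.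
have pt (g : l2 X H) x : rnorm (inner (g (t x)) (v x) *: w x) ^+ 2 <=
    rnorm (g (t x)) ^+ 2.
  rewrite ler_sqr ?nnegrE ?rnorm_ge0// rnormZ -/(cmod _).
  apply: le_trans (_ : rnorm (g (t x)) * 1 * 1 <= _); last by rewrite !mulr1.
  apply: ler_pM => //; [exact: cmod_ge0|exact: rnorm_ge0|].
  apply: le_trans (cmod_inner_le _ _) _.
  by rewrite ler_wpM2l// rnorm_ge0.
have sm (g : l2 X H) :
    rsummable (fun x => rnorm (inner (g (t x)) (v x) *: w x) ^+ 2) /\
    rsum (fun x => rnorm (inner (g (t x)) (v x) *: w x) ^+ 2) <=
      N%:R * rnorm g ^+ 2.
  apply: rsummable_fset_bnd => [x|A]; first exact: sqr_ge0.
  apply: le_trans (_ : \sum_(x <- A) rnorm (g (t x)) ^+ 2 <= _).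
    by apply: ler_sum => x _; exact: pt.
  apply: (hN (fun x => rnorm (g x) ^+ 2)) => [x|B]; first exact: sqr_ge0.
  exact: l2_sum_sqr_le.
pose T (g : l2 X H) : l2 X H := L2 ((sm g).1 :
  (fun x => inner (g (t x)) (v x) *: w x) \in @l2_pred R X H).
have TE (g : l2 X H) x : T g x = inner (g (t x)) (v x) *: w x by [].
exists T => //; split.
- split=> [a g h|].
    apply/l2_eqP => x; rewrite l2_addE l2_scaleE !TE l2_addE l2_scaleE.
    by rewrite innerDl innerZl scalerDl scalerA.
  (* Avoids the square root of [N], since [N <= (N + 1) ^ 2]. *)
  exists (N%:R + 1) => g; rewrite rnorm_le_sqr; last first.
    by rewrite mulr_ge0 ?rnorm_ge0// addr_ge0.
  rewrite l2_rnormE; apply: le_trans (sm g).2 _; rewrite exprMn.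
  rewrite ler_wpM2r ?sqr_ge0//.
  have := ler0n R N; nra.
(* Entries must vanish also at distance equal to the propagation bound, and [r] may be zero. *)
- exists (r + 1) => [|x y xy u]; first by rewrite ltr_wpDl.
  rewrite /entry TE l2_deltaE; case: eqVneq => [xt|_].
    by have := tr x; rewrite xt => /(le_trans xy); rewrite gerDl ler10.
  by rewrite inner0l scale0r.
- move=> x y; exists (fun=> w x) => u.
  by exists (fun=> inner (l2_delta y u (t x)) (v x)); rewrite big_ord1 /entry TE.
Qed.

Lemma inner_projections (H : hilbertType R) (v : X -> H) (T : l2 X H -> l2 X H)
    (g : l2 X H) :
  (forall x, T g x = inner (g x) (v x) *: v x) ->
  re (inner (T g) g) = rsum (fun x => cmod (inner (g x) (v x)) ^+ 2).
Proof.
move=> TE; rewrite -[LHS]/(rsum (fun x => re (inner (T g x) (g x)))).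
congr rsum; apply/funext => x.
by rewrite TE innerZl (innerC (v x)) conj_mul_self.
Qed.

End BoundedGeometry.

(** * Decay of the images of the sites *)

(** Finitely many balls of radius [e / 2] cover [K], and one of them receives infinitely many
    indices. *)
Lemma compact_infinite_cluster (R : realType) (H : hilbertType R) (I : Type)
    (K : set H) (k : I -> H) (Z : set I) (e : R) :
  compact K -> infinite_set Z -> (forall i, Z i -> K (k i)) -> 0 < e ->
  exists Z' : set I, [/\ infinite_set Z', Z' `<=` Z &
    forall i j, Z' i -> Z' j -> rnorm (k i - k j) <= e].
Proof.
rewrite compact_cover => cK iZ Zk e0; have e2 : 0 < e / 2 by rewrite divr_gt0.
have [|h Kh|D' _ KD'] := cK H K (fun h => ball h (e / 2)%:C).
- by move=> h _; apply: ball_open; rewrite ltcR.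
- by exists h => //; apply: ballxx; rewrite ltcR.
have [h hZ] : exists h, infinite_set (Z `&` [set i | ball h (e / 2)%:C (k i)]).
  apply: contrapT => /forallNP fin; apply: iZ.
  apply: (@sub_finite_set _ _
    (\bigcup_(h in [set` D']) (Z `&` [set i | ball h (e / 2)%:C (k i)]))).
    by move=> i Zi; have [h Dh hi] := KD' _ (Zk i Zi); exists h.
  apply: bigcup_finite => // h _; exact: contrapT (fin h).
exists (Z `&` [set i | ball h (e / 2)%:C (k i)]); split=> // i j [_ /= hi] [_ /= hj].
move: hi hj; rewrite -!ball_normE /= !rnormE !ltcR => hi hj.
rewrite -[k i - k j](subrKA h); apply: le_trans (ler_rnormD _ _) _.
by rewrite (rnormB (k i) h); lra.
Qed.

Section Transfer.
Context (R : realType).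

(** Linearity and isometry of [V] are consequences, see [unitary_pair_sym]. *)
Definition unitary_pair (E F : hilbertType R) (U : E -> F) (V : F -> E) :=
  [/\ linear U, cancel U V, cancel V U &
      forall u v, inner (U u) (U v) = inner u v].

Lemma unitary_pair_sym (E F : hilbertType R) (U : E -> F) (V : F -> E) :
  unitary_pair U V -> unitary_pair V U.
Proof.
move=> [lU UV VU iU]; split=> //.
  by move=> a u v; apply: (can_inj UV); rewrite lU !VU.
by move=> u v; rewrite -iU !VU.
Qed.

(* All that is used of Roe-type algebras: conjugation by the unitary maps the
   operators of finite propagation with entries of rank at most one into the
   closure of the locally compact operators of finite propagation. *)
Definition roe_compatible (X Y : metricType R) (HX HY : hilbertType R)
    (U : l2 X HX -> l2 Y HY) (V : l2 Y HY -> l2 X HX) :=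
  forall T, rank_one_entries T -> forall e : R, 0 < e ->
  exists S : l2 Y HY -> l2 Y HY,
    [/\ bounded_op S, finite_propagation S, locally_compact_op S &
        forall u, rnorm (U (T (V u)) - S u) <= e * rnorm u].

Section OneDirection.
Context (X Y : metricType R) (HX HY : hilbertType R).
Variables (U : l2 X HX -> l2 Y HY) (V : l2 Y HY -> l2 X HX).
Hypotheses (bgX : bounded_geometry X) (bgY : bounded_geometry Y).
Hypotheses (uUV : unitary_pair U V) (cUV : roe_compatible U V).

Let UK : cancel U V. Proof. by case: uUV. Qed.
Let VK : cancel V U. Proof. by case: uUV. Qed.

Lemma unitary_inner u v : inner (U u) v = inner u (V v).
Proof. by case: uUV => _ _ _ <-; rewrite VK. Qed.

Lemma unitary_rnorm u : rnorm (U u) = rnorm u.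
Proof.
apply/eqP; rewrite -(@eqrXn2 _ 2)// ?rnorm_ge0//.
by rewrite -!re_inner_self unitary_inner UK.
Qed.

(** The part of [u] outside [b] meets only zero entries of row [y]. Finite propagation and bounded
    geometry supply such a finite [b]. *)
Lemma op_value_ball (S : l2 Y HY -> l2 Y HY) (M : R) (b : {fset Y}) y :
  linear S -> (forall u, rnorm (S u) <= M * rnorm u) ->
  (forall z, z \notin b -> forall v, entry S y z v = 0) ->
  forall u, S u y = \sum_(z <- b) entry S y z (u z).
Proof.
move=> lS bS Sb u; rewrite -op_value_fset//; apply/eqP.
rewrite -subr_eq0 -l2_subE -(linB lS); apply/eqP.
apply: (op_value_eq0 lS bS) => z; rewrite l2_subE restrE.
have [zb|/Sb->//] := boolP (z \in b).
rewrite mem_set// subrr /entry (_ : l2_delta z 0 = 0) ?(lin0 lS)//.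
by apply/l2_eqP => x; rewrite l2_deltaE; case: ifP.
Qed.

(** The direction [v x] may vary with the site; closeness of the coarse maps needs this for the
    directions from [far_witness]. *)
Definition site_image (v : X -> HX) x : l2 Y HY := U (l2_delta x (v x)).

Section UnitFamily.
Variable v : X -> HX.
Hypothesis v1 : forall x, rnorm (v x) = 1.

Lemma rnorm_site_image x : rnorm (site_image v x) = 1.
Proof. by rewrite /site_image unitary_rnorm rnorm_delta. Qed.

Lemma inner_site_image x u : inner (site_image v x) u = inner (v x) (V u x).
Proof. by rewrite /site_image unitary_inner inner_delta. Qed.

(* If infinitely many site images had mass c at y, local compactness would make
   two of their values at y, hence infinitely many, correlate with a fixed
   vector h, while V h is square summable. *)
Lemma site_image_vanishing y (c : R) : 0 < c ->
  finite_set [set x | c <= rnorm (site_image v x y)].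
Proof.
move=> c0; apply: contrapT => iZ.
have v1' x : rnorm (v x) <= 1 by rewrite v1.
have id0 x : mdist x (id x : X) <= 0 by rewrite mdistxx.
(* [T] fixes every [delta_x (v x)], so its conjugate fixes every site image, and [S] does so up to
   [c / 6]. *)
have [T rT TE] := displacement_op bgX (lexx 0) id0 v1' v1'.
have e0 : 0 < c / 6 by rewrite divr_gt0.
have [S [[lS [M bS]] [s s0 Ss] cS ST]] := cUV rT e0.
have fixed x : U (T (V (site_image v x))) = site_image v x.
  rewrite /site_image UK; congr U; apply/l2_eqP => z; rewrite TE !l2_deltaE.
  case: eqVneq => [->|_]; last by rewrite inner0l scale0r.
  by rewrite inner_self v1 expr1n scale1r.
have close x : rnorm (site_image v x y - S (site_image v x) y) <= c / 6.
  rewrite -l2_subE; apply: le_trans (l2_rnorm_pt_le _ _) _.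
  by have := ST (site_image v x); rewrite fixed rnorm_site_image mulr1.
have [N [b [bE _]]] := bounded_geometry_fset bgY (ltW s0).
have Sval := @op_value_ball S M (b y) y lS bS _.
pose n : R := (size (b y))%:R + 1.
have n0 : 0 < n by rewrite ltr_wpDl.
have d0 : 0 < c / 6 / n by rewrite divr_gt0.
(* Compactness of the entries in row [y] lets infinite subsets be extracted for one column after
   another. *)
have cluster (l : seq Y) : exists Z' : set X, [/\ infinite_set Z',
    Z' `<=` [set x | c <= rnorm (site_image v x y)] &
    forall i j, Z' i -> Z' j -> forall z, z \in l ->
      rnorm (entry S y z (site_image v i z) - entry S y z (site_image v j z))
        <= c / 6 / n].
  elim: l => [|z l [Z [Zi Zs Zl]]]; first by eexists; split; [exact: iZ| |].
  have [|Z' [Z'i Z'Z Z'z]] := compact_infinite_cluster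
    (k := fun x => entry S y z (site_image v x z)) (cS y z) Zi _ d0.
    move=> x _; apply: subset_closure; exists (site_image v x z) => //=.
    by rewrite -(rnorm_site_image x) l2_rnorm_pt_le.
  exists Z'; split=> // [x /Z'Z/Zs//|i j Z'i' Z'j z'].
  by rewrite inE => /predU1P[->|]; [exact: Z'z|apply: Zl; exact: Z'Z].
have [Z [Zi Zs Zl]] := cluster (b y).
(* Three errors of [c / 6]: the approximation by [S] at each of the two sites, and the difference of
   the two [S]-values. *)
have near i j : Z i -> Z j ->
    rnorm (site_image v i y - site_image v j y) <= c / 2.
  move=> iz jz.
  have SS : rnorm (S (site_image v i) y - S (site_image v j) y) <= c / 6.
    rewrite !Sval; try by move=> z; rewrite bE -ltNge => /ltW; exact: Ss.
    rewrite -sumrB; apply: le_trans (rnorm_sum_le _ _) _.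
    apply: (@le_trans _ _ (\sum_(z <- b y) c / 6 / n)).
      by rewrite big_seq [leRHS]big_seq; apply: ler_sum => z; exact: Zl.
    rewrite big_const_seq count_predT iter_addr addr0 -[leLHS]mulr_natr.
    by rewrite -(mulrA (c / 6)) ger_pMr// mulrC ler_pdivrMr// mul1r lerDl.
  rewrite -[X in rnorm X](subrKA (S (site_image v i) y)).
  apply: le_trans (ler_rnormD _ _) _.
  rewrite -[X in _ + rnorm X](subrKA (S (site_image v j) y)).
  have := ler_rnormD (S (site_image v i) y - S (site_image v j) y)
    (S (site_image v j) y - site_image v j y).
  have := close i; have := close j; rewrite (rnormB (site_image v j y)); lra.
have [i0 Zi0] : Z !=set0 by apply/set0P/negP => /eqP Z0; apply: Zi; rewrite Z0.
pose u := site_image v i0 y; have cu : c <= rnorm u by exact: Zs.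
(* For [x] in [Z] the value at [y] has inner product at least [c ^ 2 / 2] in modulus with [u]. Up to
   conjugation this is the inner product of [v x] with the value at [x] of [V (l2_delta y u)], a
   vector that reaches [c ^ 2 / 2] at finitely many sites only. *)
apply: Zi; have c2 : 0 < c * c / 2 by rewrite divr_gt0// mulr_gt0.
apply: sub_finite_set (l2_ge_finite (V (l2_delta y u)) c2) => x Zx /=.
have := cmod_inner_le (v x) (V (l2_delta y u) x).
rewrite v1 mul1r -inner_site_image innerC inner_delta cmodJ; apply: le_trans.
apply: le_trans (re_le_cmod _).
rewrite -[site_image v x y](subrK u) innerDr reD re_inner_self.
have := re_inner_ge u (site_image v x y - u).
have : rnorm u * rnorm (site_image v x y - u) <= rnorm u * (c / 2).
  by rewrite ler_wpM2l ?rnorm_ge0//; exact: near.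
nra.
Qed.

End UnitFamily.
End OneDirection.
End Transfer.

(** * Property A and Schur multipliers *)

Section PropertyA.
Context (R : realType) (Y : metricType R).

(** [xi y] is the indicator of [A y], normalised in the square-summable sense. The sums run over any
    finite [W] containing [A y], so that one [W] can serve finitely many [y]. *)
Lemma property_A_partition (s e : R) : property_A Y -> 0 < s -> 0 < e ->
  exists (D : R) (A : Y -> {fset Y * nat}) (xi : Y -> Y * nat -> R),
    [/\ forall y z, 0 <= xi y z,
        forall y (W : {fset Y * nat}), (A y `<=` W)%fset ->
          \sum_(z <- W) xi y z ^+ 2 = 1,
        forall y y' (W : {fset Y * nat}), (A y `<=` W)%fset ->
          mdist y y' <= s -> 1 - e <= \sum_(z <- W) xi y z * xi y' z &
        forall y y' z, xi y z != 0 -> xi y' z != 0 -> mdist y y' <= D].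
Proof.
move=> pA s0 e0; have [A [A1 Anear [D D0 AD]]] := pA s e s0 e0.
pose q y : R := Num.sqrt (#|` A y|)%:R.
have card_gt0 y : (0 < #|` A y|)%N.
  by rewrite cardfs_gt0; apply/fset0Pn; exists (y, 1%N).
have q0 y : 0 < q y by rewrite sqrtr_gt0 ltr0n.
have q2 y : q y ^+ 2 = (#|` A y|)%:R by rewrite sqr_sqrtr.
pose xi y z : R := if z \in A y then (q y)^-1 else 0.
have sumW y (W : {fset Y * nat}) (F : Y * nat -> R) : (A y `<=` W)%fset ->
    (forall z, z \notin A y -> F z = 0) ->
    \sum_(z <- W) F z = \sum_(z <- A y) F z.
  by move=> AW F0; rewrite -(big_fset_incl _ AW) // => z _; exact: F0.
(* As [(y, 1)] lies in [A y], the first coordinate of any [z] in [A y] is within [D] of [y]; two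
   points sharing [z] are thus within [D + D]. *)
exists (D + D), A, xi; split.
- by move=> y z; rewrite /xi; case: ifP => // _; rewrite invr_ge0 ltW.
- move=> y W AW; rewrite (sumW y)// => [|z /negbTE zA]; last first.
    by rewrite /xi zA expr0n.
  rewrite (eq_big_seq (fun=> (q y)^-1 ^+ 2)) => [|z zA]; last by rewrite /xi zA.
  rewrite big_const_seq count_predT iter_addr addr0 -[LHS]mulr_natl -q2.
  by rewrite -exprMn mulfV ?expr1n ?gt_eqF.
- move=> y y' W AW yy'; rewrite (sumW y)// => [|z /negbTE zA]; last first.
    by rewrite /xi zA mul0r.
  have [m0 small] := Anear _ _ yy'.
  set I := (A y `&` A y')%fset in m0 small.
  have -> : \sum_(z <- A y) xi y z * xi y' z = \sum_(z <- I) (q y)^-1 * (q y')^-1.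
    rewrite -(big_fset_incl _ (fsubsetIl (A y) (A y'))) /=.
      apply: eq_big_seq => z; rewrite /I inE /xi => /andP[-> ->]//.
    by move=> z zA; rewrite /I inE zA /= /xi => /negbTE->; rewrite mulr0.
  rewrite big_const_seq count_predT iter_addr addr0 -[leRHS]mulr_natl.
  have m1 : 0 < (#|` I|)%:R :> R by rewrite ltr0n cardfs_gt0.
  (* Both cardinalities are at most [1 + e] times that of [I], hence so is their geometric mean
     [q y * q y']; the overlap is then at least [1 / (1 + e)], which is at least [1 - e]. *)
  have bnd (B C : {fset Y * nat}) : (B `&` C)%fset = I ->
      (B `\` C `<=` (A y `\` A y') `|` (A y' `\` A y))%fset ->
      (#|` B|)%:R <= (1 + e) * (#|` I|)%:R :> R.
    move=> BC sub; rewrite -(cardfsID C B) BC natrD mulrDl mul1r lerD2l.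
    move: small; rewrite ltr_pdivrMr// => /ltW; apply: le_trans.
    by rewrite ler_nat fsubset_leq_card.
  have b1 := bnd (A y) (A y') erefl (fsubsetUl _ _).
  have b2 := bnd (A y') (A y) (fsetIC _ _) (fsubsetUr _ _).
  rewrite -!q2 in b1 b2; rewrite -invfM ler_pdivlMr ?mulr_gt0//.
  have : q y * q y' <= (1 + e) * (#|` I|)%:R.
    have := sqr_ge0 (q y - q y'); rewrite sqrrB; lra.
  have [e1|e1] := leP 1 e; first by have := mulr_gt0 (q0 y) (q0 y'); nra.
  move=> h; apply: le_trans (ler_wpM2l _ h) _; first by rewrite subr_ge0 ltW.
  by rewrite mulrA ger_pMl//; nra.
- move=> y y' z; rewrite /xi; case: ifP; rewrite ?eqxx// => zy _.
  case: ifP; rewrite ?eqxx// => zy' _.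
  case: z zy zy' => w m zy zy'; apply: le_trans (metric_triangle _ w _) _.
  by rewrite lerD//; [exact: AD (A1 y) zy|exact: AD zy' (A1 y')].
Qed.

End PropertyA.

(** * Cutting a vector by a partition of unity *)

Section Partition.
Context (R : realType) (Y : metricType R) (H : hilbertType R) (I : choiceType).
Variables (xi : Y -> I -> R) (W : {fset I}) (F : {fset Y}) (f : l2 Y H).
Hypothesis xi_ge0 : forall y z, 0 <= xi y z.
Hypothesis xi_sqr : forall y, y \in F -> \sum_(z <- W) xi y z ^+ 2 = 1.

(** The Schur multiplier of the partition, equal to one on the diagonal over [F]. *)
Let k y y' : R := \sum_(z <- W) xi y z * xi y' z.

Let k_le1 y y' : y \in F -> y' \in F -> k y y' <= 1.
Proof.
move=> yF yF'; rewrite -(ler_pM2l (ltr0n R 2)) /k mulr_sumr mulr1.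
apply: (@le_trans _ _ (\sum_(z <- W) (xi y z ^+ 2 + xi y' z ^+ 2))).
  by apply: ler_sum => z _; have := sqr_ge0 (xi y z - xi y' z); rewrite sqrrB; lra.
by rewrite big_split /= !xi_sqr//; lra.
Qed.

(** Pointwise product of [f] with [xi _ z] over [F], written as a finite sum of sites so that
    operators and inner products expand term by term. *)
Definition piece z : l2 Y H := \sum_(y <- F) (xi y z)%:C *: l2_delta y (f y).

Lemma pieceE z y : piece z y = if y \in F then (xi y z)%:C *: f y else 0.
Proof.
have -> : piece z = restr [set` F] (\sum_(y <- F) (xi y z)%:C *: l2_delta y (f y)).
  apply/l2_eqP => w; rewrite restrE; case: ifPn => // wF.
  rewrite /piece l2_sumE big_seq big1// => u uF.
  rewrite l2_scaleE l2_deltaE; case: eqVneq => [wu|]; last by rewrite scaler0.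
  by move: wF; rewrite wu mem_set.
rewrite restrE; have -> : (y \in [set` F]) = (y \in F).
  by apply/idP/idP; rewrite inE.
case: ifPn => // yF; rewrite l2_sumE (big_fsetD1 y yF) big_seq big1 => [|u].
  by rewrite l2_scaleE l2_deltaE eqxx; exact: addr0.
by rewrite !inE l2_scaleE l2_deltaE eq_sym => /andP[/negbTE-> _]; rewrite scaler0.
Qed.

Let sum_piece_form (beta : Y -> Y -> R) :
  \sum_(z <- W) \sum_(y <- F) \sum_(y' <- F) xi y z * xi y' z * beta y y' =
  \sum_(y <- F) \sum_(y' <- F) k y y' * beta y y'.
Proof.
rewrite exchange_big /=; apply: eq_bigr => y _; rewrite exchange_big /=.
by apply: eq_bigr => y' _; rewrite mulr_suml.
Qed.

Lemma rnorm_piece : \sum_(z <- W) rnorm (piece z) ^+ 2 = rnorm (restr [set` F] f) ^+ 2.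
Proof.
rewrite rnorm_restr_fset.
transitivity (\sum_(z <- W) \sum_(y <- F) xi y z ^+ 2 * rnorm (f y) ^+ 2).
  apply: eq_bigr => z _; rewrite -re_inner_self {1}/piece inner_suml re_sum.
  apply: eq_big_seq => y yF; rewrite innerZl inner_delta pieceE yF innerZr conjR.
  by rewrite !reZ re_inner_self mulrA -expr2.
rewrite exchange_big /=; apply: eq_big_seq => y yF.
by rewrite -mulr_suml xi_sqr// mul1r.
Qed.

(** Expanding the squares and summing over [z] first leaves the multiplier [k], which is at most
    one; the bound does not grow with the number of pieces. *)
Lemma piece_overlap (g : l2 Y H) :
  \sum_(z <- W) cmod (inner (piece z) g) ^+ 2 <=
    (\sum_(y <- F) rnorm (f y) * rnorm (g y)) ^+ 2.
Proof.
pose p y := rnorm (f y) * rnorm (g y).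
have p0 y : 0 <= p y by rewrite mulr_ge0 ?rnorm_ge0.
apply: (@le_trans _ _ (\sum_(z <- W) (\sum_(y <- F) xi y z * p y) ^+ 2)).
  apply: ler_sum => z _; rewrite ler_sqr ?nnegrE ?cmod_ge0//; last first.
    by apply: sumr_ge0 => y _; rewrite mulr_ge0.
  rewrite inner_suml; apply: le_trans (cmod_sum _ _) _; apply: ler_sum => y _.
  rewrite innerZl inner_delta cmodM cmodR ger0_norm// ler_wpM2l//.
  exact: cmod_inner_le.
have sq (G : Y -> R) : (\sum_(y <- F) G y) ^+ 2 =
    \sum_(y <- F) \sum_(y' <- F) G y * G y'.
  by rewrite expr2 mulr_suml; apply: eq_bigr => y _; rewrite mulr_sumr.
rewrite sq; under eq_bigr do rewrite sq.
rewrite (_ : \sum_(z <- W) _ = \sum_(y <- F) \sum_(y' <- F) k y y' * (p y * p y')).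
  rewrite big_seq [leRHS]big_seq; apply: ler_sum => y yF.
  rewrite big_seq [leRHS]big_seq; apply: ler_sum => y' yF'.
  exact: ler_piMl (mulr_ge0 (p0 y) (p0 y')) (k_le1 yF yF').
rewrite -sum_piece_form; apply: eq_bigr => z _; apply: eq_bigr => y _.
by apply: eq_bigr => y' _; rewrite mulrACA.
Qed.

(* Cutting by the partition is a Schur multiplication by k, and k is close to
   one where the matrix of S is supported. *)
Lemma piece_local_op (S : l2 Y H -> l2 Y H) (M s e : R) (N : nat) (b : Y -> {fset Y}) :
  linear S -> 0 <= M -> (forall u, rnorm (S u) <= M * rnorm u) ->
  (forall x y, s <= mdist x y -> forall v, entry S x y v = 0) ->
  (forall x y, (y \in b x) = (mdist x y <= s)) -> (forall x, (#|` b x| <= N)%N) ->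
  0 <= e ->
  (forall y y', y \in F -> y' \in F -> mdist y y' <= s ->
    1 - e <= \sum_(z <- W) xi y z * xi y' z) ->
  re (inner (S (restr [set` F] f)) (restr [set` F] f))
    - e * M * N%:R * rnorm (restr [set` F] f) ^+ 2 <=
  \sum_(z <- W) re (inner (S (piece z)) (piece z)).
Proof.
move=> lS M0 bS Ss bE bN e0 ke.
pose beta y y' := re (inner (S (l2_delta y (f y))) (l2_delta y' (f y'))).
have -> : \sum_(z <- W) re (inner (S (piece z)) (piece z)) =
    \sum_(y <- F) \sum_(y' <- F) k y y' * beta y y'.
  rewrite -sum_piece_form; apply: eq_bigr => z _.
  rewrite /piece (lin_sum lS) inner_suml re_sum; apply: eq_bigr => y _.
  rewrite inner_sumr re_sum; apply: eq_bigr => y' _.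
  by rewrite (linZ lS) innerZl innerZr conjR !reZ mulrA.
have -> : re (inner (S (restr [set` F] f)) (restr [set` F] f)) =
    \sum_(y <- F) \sum_(y' <- F) beta y y'.
  rewrite restr_fsetE (lin_sum lS) inner_suml re_sum; apply: eq_bigr => y _.
  by rewrite inner_sumr re_sum.
rewrite lerBlDr -lerBlDl -sumrB.
pose c (y y' : Y) : R := (mdist y y' <= s)%R%:R.
pose h y := rnorm (f y) ^+ 2.
(* A pair at distance at most [s] loses at most [e * M] times the product of the two norms. The
   arithmetic mean shares this between the two ends, and each end has at most [N] partners. *)
apply: (@le_trans _ _ (\sum_(y <- F) \sum_(y' <- F)
    e * M / 2 * (c y y' * h y + c y' y * h y'))).
  rewrite big_seq [leRHS]big_seq; apply: ler_sum => y yF.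
  rewrite -sumrB big_seq [leRHS]big_seq; apply: ler_sum => y' yF'.
  rewrite /c (metric_sym y' y); have [yy'|yy'] := leP (mdist y y') s; last first.
    rewrite !mul0r addr0 mulr0 (_ : beta y y' = 0) ?mulr0 ?subr0//.
    rewrite /beta innerC inner_delta -/(entry S y' y (f y)) Ss ?inner0r//.
    by rewrite metric_sym ltW.
  have := ke _ _ yF yF' yy'; rewrite -/(k y y'); have := k_le1 yF yF' => k1 k2.
  have hb : beta y y' <= M * (rnorm (f y) * rnorm (f y')).
    apply: le_trans (re_inner_le _ _) _; rewrite rnorm_delta mulrA.
    apply: ler_wpM2r; first exact: rnorm_ge0.
    by rewrite -(rnorm_delta y (f y)); exact: bS.
  have := sqr_ge0 (rnorm (f y) - rnorm (f y')); rewrite sqrrB => hh.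
  have : M * (rnorm (f y) * rnorm (f y')) <= M * ((h y + h y') / 2).
    by rewrite ler_wpM2l// /h; lra.
  set C := M * ((h y + h y') / 2) => hC.
  have C0 : 0 <= C by rewrite mulr_ge0// divr_ge0// addr_ge0// sqr_ge0.
  have -> : e * M / 2 * (1 * h y + 1 * h y') = e * C by rewrite /C; field.
  rewrite -{1}[beta y y']mul1r -mulrBl.
  apply: (@le_trans _ _ ((1 - k y y') * C)); last by rewrite ler_wpM2r//; lra.
  by rewrite ler_wpM2l ?subr_ge0//; exact: le_trans hC.
have deg y : \sum_(y' <- F) c y y' <= N%:R.
  apply: le_trans (sum_indicator_le R _ (B := b y) (P := fun y' => mdist y y' <= s) _) _; last by rewrite ler_nat.
  by move=> y'; rewrite bE.
have half : \sum_(y <- F) \sum_(y' <- F) c y y' * h y <= N%:R * rnorm (restr [set` F] f) ^+ 2.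
  rewrite rnorm_restr_fset mulr_sumr; apply: ler_sum => y _.
  by rewrite -mulr_suml ler_wpM2r ?sqr_ge0.
under eq_bigr do rewrite -mulr_sumr big_split /=.
rewrite -mulr_sumr big_split /= [X in _ + X]exchange_big /=.
have eM : 0 <= e * M by rewrite mulr_ge0.
have := ler_wpM2l eM half; lra.
Qed.

End Partition.

(** * Uniform concentration *)

Section SequenceSums.
Context (R : realType) (X : choiceType).

(** Every point of the range picks one of its indices, and distinct points use distinct indices, so
    repetitions in [x] do no harm. *)
Lemma sum_range_le (G : X -> R) (x : nat -> X) (w : nat -> R) (C : R) (E : {fset X}) :
  (forall z, 0 <= G z) -> (forall z, (forall m, x m <> z) -> G z = 0) ->
  (forall m, G (x m) <= w m) -> (forall M, \sum_(m < M) w m <= C) ->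
  \sum_(z <- E) G z <= C.
Proof.
move=> G0 Gz Gw wC.
have /choice[idx idxE] z : exists m, (exists m, x m = z) -> x m = z.
  have [[m <-]|h] := pselect (exists m, x m = z); first by exists m.
  by exists 0%N => /h.
pose M := (\max_(z <- E) idx z).+1.
apply: le_trans (wC M).
apply: (@le_trans _ _ (\sum_(z <- E) \sum_(m < M) (z == x m)%:R * G (x m))).
  rewrite big_seq [leRHS]big_seq; apply: ler_sum => z zE.
  have [|h] := pselect (exists m, x m = z); last first.
    rewrite Gz; first by apply: sumr_ge0 => m _; rewrite mulr_ge0.
    by move=> m xm; apply: h; exists m.
  move=> /idxE xz; have zM : (idx z < M)%N.
    by rewrite ltnS; exact: leq_bigmax_seq.
  rewrite (bigD1 (Ordinal zM))//= xz eqxx mul1r lerDl.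
  by apply: sumr_ge0 => m _; rewrite mulr_ge0.
rewrite exchange_big /=; apply: ler_sum => m _; rewrite -mulr_suml.
apply: le_trans (Gw m); rewrite -[leRHS]mul1r ler_wpM2r//.
rewrite -[leRHS]/(1%:R) -(cardfs1 (x m)); apply: (sum_indicator_le R E (P := fun z => z == x m)) => z.
by rewrite inE.
Qed.

Lemma geometric_le1 M : \sum_(m < M) (2 ^- m.+1 : R) <= 1.
Proof.
suff -> : \sum_(m < M) (2 ^- m.+1 : R) = 1 - 2 ^- M by rewrite gerBl invr_ge0 exprn_ge0.
elim: M => [|M IH]; first by rewrite big_ord0 expr0 invr1 subrr.
by rewrite big_ord_recr /= IH exprS; field; rewrite expf_neq0.
Qed.

Lemma rsum_sum (I : Type) (s : seq I) (F : I -> X -> R) :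
  (forall i, rsummable (F i)) ->
  rsummable (fun x => \sum_(i <- s) F i x) /\
  rsum (fun x => \sum_(i <- s) F i x) = \sum_(i <- s) rsum (F i).
Proof.
move=> sF; elim: s => [|i s [IH1 IH2]].
  rewrite big_nil (_ : (fun=> _) = fun=> 0); last first.
    by apply/funext => x; rewrite big_nil.
  have [s0 r0] : rsummable (fun _ : X => 0 : R) /\ rsum (fun _ : X => 0 : R) <= 0.
    by apply: rsummable_fset_bnd => // A; rewrite big1.
  by split=> //; apply/eqP; rewrite eq_le r0 rsum_ge0.
rewrite big_cons (_ : (fun=> _) = F i \+ fun x => \sum_(j <- s) F j x); last first.
  by apply/funext => x; rewrite big_cons.
by rewrite rsumD// IH2; split=> //; exact: rsummableD.
Qed.

End SequenceSums.

Section Concentration.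
Context (R : realType) (X Y : metricType R) (HX HY : hilbertType R).
Variables (U : l2 X HX -> l2 Y HY) (V : l2 Y HY -> l2 X HX).
Hypotheses (bgX : bounded_geometry X) (bgY : bounded_geometry Y).
Hypotheses (pAY : property_A Y).
Hypotheses (uUV : unitary_pair U V) (cUV : roe_compatible U V).

Lemma bounded_op_ge0 (E : hilbertType R) (S : E -> E) : bounded_op S ->
  linear S /\ exists2 M : R, 0 <= M & forall u, rnorm (S u) <= M * rnorm u.
Proof.
move=> [lS [M bS]]; split=> //; exists `|M| => // u.
by apply: le_trans (bS u) _; rewrite ler_wpM2r ?rnorm_ge0 ?ler_norm.
Qed.

Lemma fset_diam (A : {fset Y}) :
  exists D : R, forall y y', y \in A -> y' \in A -> mdist y y' <= D.
Proof.
have le_sum (G : Y -> R) z : (forall w, 0 <= G w) -> z \in A ->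
    G z <= \sum_(w <- A) G w.
  by move=> G0 zA; rewrite (big_fsetD1 z zA) /= lerDl sumr_ge0.
exists (\sum_(y <- A) \sum_(y' <- A) mdist y y') => y y' yA y'A.
apply: (@le_trans _ _ (\sum_(y'' <- A) mdist y y'')).
  by apply: (le_sum (mdist y)) => // w; exact: mdist_ge0.
apply: (le_sum (fun z => \sum_(y'' <- A) mdist z y'')) => // w.
by apply: sumr_ge0 => z _; exact: mdist_ge0.
Qed.

Section UnitFamily.
Variable v : X -> HX.
Hypothesis v1 : forall x, rnorm (v x) = 1.

Local Notation f := (site_image U v).

Let f1 x : rnorm (f x) = 1. Proof. exact: (rnorm_site_image uUV v1). Qed.

(** Finite partial sums express the bound on the sum over all of [Y] without a summability side
    condition. *)
Definition small_overlap (c : R) x x' :=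
  forall F : {fset Y}, \sum_(y <- F) rnorm (f x y) * rnorm (f x' y) <= c.

(** On a finite set carrying most of [f x], all but finitely many site images are small by
    [site_image_vanishing]; the tail of [f x] is paired with [f x'] by a weighted mean
    inequality. *)
Lemma small_overlap_cofinite x (c : R) : 0 < c ->
  finite_set [set x' | ~ small_overlap c x x'].
Proof.
move=> c0; have c4 : 0 < c / 4 by rewrite divr_gt0.
have [A hA] := restr_approx (f x) c4.
pose d : R := c / 4 / ((size A)%:R + 1).
have n0 : 0 < (size A)%:R + 1 :> R by rewrite ltr_wpDl.
have d0 : 0 < d by rewrite divr_gt0.
apply: (@sub_finite_set _ _
    (\bigcup_(y in [set` A]) [set x' | d <= rnorm (f x' y)])); last first.
  by apply: bigcup_finite => // y _; exact: (site_image_vanishing bgX bgY uUV cUV v1).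
move=> x' /= nso; apply: contrapT => far; apply: nso => F.
have dist y : y \in A -> rnorm (f x' y) <= d.
  by move=> yA; rewrite leNgt; apply/negP => /ltW dy; apply: far; exists y.
pose t := f x - restr [set` A] (f x).
have split_t y : rnorm (f x y) <= (y \in A)%:R + rnorm (t y).
  rewrite /t l2_subE restrE; have -> : (y \in [set` A]) = (y \in A).
    by apply/idP/idP; rewrite inE.
  case: ifP => _; last by rewrite subr0 add0r.
  by rewrite subrr rnorm0 addr0 -(f1 x) l2_rnorm_pt_le.
(* With weight [c / 2] the bound consists of [c / 4] on [A], [c / 8] from the tail and [c / 2] from
   [f x']. *)
apply: (@le_trans _ _ (\sum_(y <- F) ((y \in A)%:R * d +
    (rnorm (t y) ^+ 2 / (c / 2) + (c / 2) * rnorm (f x' y) ^+ 2)))).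
  apply: ler_sum => y _.
  apply: le_trans (ler_wpM2r (rnorm_ge0 _) (split_t y)) _; rewrite mulrDl.
  apply: lerD.
    have [/dist yA|_] := boolP (y \in A); last by rewrite !mul0r.
    by rewrite ler_wpM2l.
  have c2 : 0 < c / 2 by rewrite divr_gt0.
  have := sqr_ge0 (rnorm (t y) / (c / 2) - rnorm (f x' y)).
  move/(mulr_ge0 (ltW c2)); set p := rnorm (t y); set q := rnorm (f x' y).
  have pq : 0 <= p * q by rewrite mulr_ge0 ?rnorm_ge0.
  rewrite (_ : c / 2 * (p / (c / 2) - q) ^+ 2 = p ^+ 2 / (c / 2) + c / 2 * q ^+ 2 - 2 * (p * q)); last first.
    by field; rewrite gt_eqF.
  lra.
rewrite !big_split /= -!mulr_suml -mulr_sumr.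
have h1 : (\sum_(y <- F) (y \in A)%:R) * d <= c / 4.
  apply: (@le_trans _ _ ((size A)%:R * d)).
    rewrite ler_wpM2r ?(ltW d0)//.
    exact: (sum_indicator_le R F (P := fun y => y \in A)).
  rewrite /d mulrCA ger_pMr// ler_pdivrMr// mul1r lerDl//.
have h2 : (\sum_(y <- F) rnorm (t y) ^+ 2) / (c / 2) <= c / 8.
  rewrite ler_pdivrMr ?divr_gt0//; apply: le_trans (l2_sum_sqr_le _ _) _.
  have := hA; rewrite rnorm_le_sqr ?(ltW c4)// -/t; lra.
have h3 : c / 2 * (\sum_(y <- F) rnorm (f x' y) ^+ 2) <= c / 2.
  rewrite ger_pMr ?divr_gt0//; apply: le_trans (l2_sum_sqr_le _ _) _.
  by rewrite f1 expr1n.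
lra.
Qed.

Definition concentrated (e D : R) (u : l2 Y HY) :=
  exists B : set Y, (forall y y', B y -> B y' -> mdist y y' <= D) /\
    1 - e <= rnorm (restr B u) ^+ 2.

Lemma concentrated_le e D D' u : D <= D' -> concentrated e D u -> concentrated e D' u.
Proof.
move=> DD [B [BD Bu]]; exists B; split=> // y y' yB y'B.
exact: le_trans (BD _ _ yB y'B) DD.
Qed.

Lemma concentrated_finite (e : R) (E : set X) : 0 < e -> finite_set E ->
  exists D, forall x, E x -> concentrated e D (f x).
Proof.
(* The minimum with one gives [e' ^ 2 <= e], turning a norm bound into a mass bound. *)
move=> e0 fE; pose e' := Num.min e 1.
have e'0 : 0 < e' by rewrite lt_min e0 ltr01.
have ee : e' ^+ 2 <= e.
  have : e' <= 1 by rewrite ge_min lexx orbT.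
  have : e' <= e by rewrite ge_min lexx.
  nra.
have /choice[D hD] x : exists D, concentrated e D (f x).
  have [A hA] := restr_approx (f x) e'0; have [D AD] := fset_diam A.
  exists D, [set` A]; split; first by move=> y y'; exact: AD.
  have := rnorm_restrC [set` A] (f x); rewrite f1 expr1n.
  move: hA; rewrite rnorm_le_sqr ?(ltW e'0)//; lra.
exists (\sum_(x <- fset_set E) `|D x|) => x Ex.
apply: concentrated_le (hD x); rewrite (big_fsetD1 x) /=; last first.
  by rewrite in_fset_set ?inE.
apply: le_trans (ler_norm _) _; rewrite lerDl; exact: sumr_ge0.
Qed.

(** The sites overlapping too much with those already chosen form a finite set, concentrated at a
    common scale [D]. A site not concentrated at a scale above both [D] and [n] lies outside that
    set and is the next choice. *)
Lemma spread_sequence (e t : R) : 0 < e -> 0 < t ->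
  (forall D, exists x, ~ concentrated e D (f x)) ->
  exists x : nat -> X, (forall n, ~ concentrated e n%:R (f (x n))) /\
    forall m n, m != n -> small_overlap (t / 2 ^+ m.+1) (x m) (x n).
Proof.
move=> e0 t0 bad.
have /choice[next nextP] (l : seq X) : exists x,
    ~ concentrated e (size l)%:R (f x) /\
    forall x', x' \in l -> small_overlap (t / 2 ^+ (size l).+1) x' x.
  pose E := \bigcup_(x' in [set` l])
    [set x | ~ small_overlap (t / 2 ^+ (size l).+1) x' x].
  have fE : finite_set E.
    apply: bigcup_finite => [|x' _]; first exact: finite_seq.
    by apply: small_overlap_cofinite; rewrite divr_gt0 ?exprn_gt0.
  have [D hD] := concentrated_finite e0 fE.
  have [x xD] := bad (Num.max D (size l)%:R); exists x; split.
    by apply: contra_not xD; apply: concentrated_le; rewrite le_max lexx orbT.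
  move=> x' x'l; apply: contrapT => nso; apply: xD.
  apply: concentrated_le (hD x _); first by rewrite le_max lexx.
  by exists x'.
pose L n := iter n (fun l => next l :: l) [::].
have sL n : size (L n) = n by elim: n => //= n ->.
have inL m n : (m < n)%N -> next (L m) \in L n.
  elim: n => // n IH; rewrite ltnS leq_eqVlt => /predU1P[->|/IH h] /=.
    by rewrite mem_head.
  by rewrite inE h orbT.
exists (fun n => next (L n)); split=> [n|m n].
  by have := (nextP (L n)).1; rewrite sL.
(* The later index controls the overlap; when it is [n], the bound is even smaller than required. *)
rewrite neq_ltn => /orP[mn|nm] F; last first.
  have := (nextP (L m)).2 _ (inL _ _ nm) F; rewrite sL; apply: le_trans.
  by apply: ler_sum => y _; rewrite mulrC.
have := (nextP (L n)).2 _ (inL _ _ mn) F; rewrite sL => /le_trans; apply.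
rewrite ler_pM2l// lef_pV2 ?posrE ?exprn_gt0//.
apply: ler_weXn2l; first by rewrite ler1n.
by rewrite ltnS ltnW.
Qed.

Lemma site_image_concentrated (e : R) : 0 < e ->
  exists D, forall x, concentrated e D (f x).
Proof.
move=> e0; apply: contrapT => /forallNP bad.
(* The lower bound below loses [5 * t] and the upper bound [t], so [6 * t < e] yields the
   contradiction. *)
pose t := Num.min 1 e / 16.
have t0 : 0 < t by rewrite divr_gt0// lt_min ltr01.
have te : 16 * t <= e by rewrite mulrC divfK// ge_min lexx orbT.
have t1 : 16 * t <= 1 by rewrite mulrC divfK// ge_min lexx.
have {}bad D : exists x, ~ concentrated e D (f x).
  by have /existsNP := bad D.
have [x [xbad xover]] := spread_sequence e0 t0 bad.
(* For [e > 1] even the empty set would witness concentration. *)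
have e1 : 0 <= 1 - e.
  rewrite leNgt; apply/negP => e1; apply: (xbad 0%N); exists set0; split=> //.
  by rewrite (le_trans (ltW e1))// sqr_ge0.
(* Zero off the sequence, so that [T] below is the projection onto the span of the chosen sites. *)
pose va z : HX := if z \in range x then v z else 0.
have va1 z : rnorm (va z) <= 1.
  by rewrite /va; case: ifP => _; rewrite ?v1 ?rnorm0 ?ler01.
have vax n : va (x n) = v (x n) by rewrite /va mem_set//; exists n.
have id0 z : mdist z (id z : X) <= 0 by rewrite mdistxx.
have [T rT TE] := displacement_op bgX (lexx 0) id0 va1 va1.
have [S [oS [s s0 Ss] _ ST]] := cUV rT t0.
have [lS [M M0 bS]] := bounded_op_ge0 oS.
have [N [b [bE bN]]] := bounded_geometry_fset bgY (ltW s0).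
(* The multiplier costs [eta * M * N]; the added one keeps the denominator positive. *)
pose eta := t / (M * N%:R + 1).
have MN : 0 <= M * N%:R by rewrite mulr_ge0.
have eta0 : 0 < eta by rewrite divr_gt0// ltr_wpDl.
have etaMN : eta * M * N%:R <= t.
  rewrite -mulrA /eta mulrAC -mulrA ger_pMr// ler_pdivrMr ?ltr_wpDl//; lra.
have [D [A [xi [xi0 xi1 xinear xidiam]]]] := property_A_partition pAY s0 eta0.
have [n Dn] : exists n : nat, D <= n%:R.
  exists (Num.bound `|D|).
  exact: le_trans (ler_norm D) (ltW (archi_boundP (normr_ge0 D))).
(* Truncation to a finite [F] keeps the index set [W] of the partition finite. *)
have [F hF] := restr_approx (f (x n)) t0.
set g := restr [set` F] (f (x n)) in hF.
have AW y : y \in F -> (A y `<=` \bigcup_(y <- F) A y)%fset.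
  by move=> yF; exact: bigfcup_sup.
set W := (\bigcup_(y <- F) A y)%fset in AW.
pose q u := re (inner (U (T (V u))) u).
pose h z := piece xi F (f (x n)) z.
have xi_sqr y : y \in F -> \sum_(z <- W) xi y z ^+ 2 = 1 by move=> /AW; exact: xi1.
have qS u : `|q u - re (inner (S u) u)| <= t * rnorm u ^+ 2.
  rewrite /q -reN -reD -innerBl; apply: le_trans (norm_re_le_cmod _) _.
  apply: le_trans (cmod_inner_le _ _) _; rewrite expr2 mulrA.
  by rewrite ler_wpM2r ?rnorm_ge0 ?ST.
have qE u : rsummable (fun z => cmod (inner (V u z) (va z)) ^+ 2) /\
    q u = rsum (fun z => cmod (inner (V u z) (va z)) ^+ 2).
  split; last first.
    by rewrite /q (unitary_inner uUV) (inner_projections (TE (V u))).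
  apply: rsummable_le (l2_sqsummable (V u)) => z.
  rewrite !ger0_norm ?sqr_ge0// ler_sqr ?nnegrE ?rnorm_ge0 ?cmod_ge0//.
  apply: le_trans (cmod_inner_le _ _) _.
  by rewrite -[leRHS]mulr1 ler_wpM2l ?rnorm_ge0.
have gle1 : rnorm g ^+ 2 <= 1.
  by rewrite -[leRHS](expr1n _ 2) -rnorm_le_sqr// -(f1 (x n)) rnorm_restr_le.
have gge : 1 - t <= rnorm g ^+ 2.
  have := rnorm_restrC [set` F] (f (x n)); rewrite f1 expr1n -/g.
  have := hF; rewrite rnorm_le_sqr ?(ltW t0)//.
  have : t ^+ 2 <= t by rewrite expr2 ger_pMl//; lra.
  lra.
(* The term at [x n] alone is the fourth power of the norm of [g]. *)
have qg : 1 - 2 * t <= q g.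
  have [sq ->] := qE g.
  have := @rsum_fset_le _ _ _ [fset x n]%fset sq (fun z => sqr_ge0 _).
  rewrite big_seq_fset1 vax innerC cmodJ -(inner_site_image uUV) innerC cmodJ.
  rewrite /g inner_restr -/g inner_self cmodR ger0_norm ?sqr_ge0//.
  by apply: le_trans; nra.
have hsum : \sum_(z <- W) rnorm (h z) ^+ 2 = rnorm g ^+ 2 by exact: rnorm_piece.
(* Passing from [q] to [S], applying the multiplier and returning to [q] cost [t] each, on top of
   the [2 * t] in [qg]. *)
have lower : 1 - 5 * t <= \sum_(z <- W) q (h z).
  have near y y' : y \in F -> y' \in F -> mdist y y' <= s ->
      1 - eta <= \sum_(z <- W) xi y z * xi y' z.
    by move=> yF _; apply: xinear; exact: AW.
  have := @piece_local_op _ _ _ _ xi W F (f (x n)) xi_sqr S M s eta N b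
    lS M0 bS Ss bE bN (ltW eta0) near; rewrite -/g.
  have := qS g; rewrite ler_norml => /andP[_ qSg].
  have : eta * M * N%:R * rnorm g ^+ 2 <= t.
    apply: le_trans etaMN; apply: ler_piMr => //.
    by rewrite -mulrA mulr_ge0// ltW.
  have : \sum_(z <- W) re (inner (S (h z)) (h z)) - t * \sum_(z <- W) rnorm (h z) ^+ 2
      <= \sum_(z <- W) q (h z).
    rewrite mulr_sumr -sumrB; apply: ler_sum => z _.
    have := qS (h z); rewrite ler_norml => /andP[]; lra.
  have : t * rnorm g ^+ 2 <= t by rewrite ger_pMr.
  rewrite hsum; lra.
(* As a sum over sites, only the points [x m] contribute: the term at [x n] is bounded by the
   failure of concentration, the others by small overlap. *)
have upper : \sum_(z <- W) q (h z) <= 1 - e + t.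
  pose G w := \sum_(z <- W) cmod (inner (V (h z) w) (va w)) ^+ 2.
  have [sG sumG] := rsum_sum W (fun z => (qE (h z)).1).
  under eq_bigr do rewrite (qE _).2; rewrite -sumG.
  have G0 w : 0 <= G w by apply: sumr_ge0 => z _; exact: sqr_ge0.
  have Gx m : G (x m) = \sum_(z <- W) cmod (inner (h z) (f (x m))) ^+ 2.
    apply: eq_bigr => z _; rewrite vax innerC cmodJ -(inner_site_image uUV).
    by rewrite innerC cmodJ.
  pose w m : R := (m == n)%:R * (1 - e) + t * 2 ^- m.+1.
  apply: (rsummable_fset_bnd G0 _).2 => E.
  apply: (@sum_range_le _ _ G x w) => // [z xz|m|K].
  - rewrite /G big1// => i _; rewrite /va memNset; last by move=> [m _ /xz].
    by rewrite inner0r cmod0 expr0n.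
  - rewrite Gx /w; have [->|mn] := eqVneq m n; last first.
      rewrite mul0r add0r.
      have := @piece_overlap _ _ _ _ xi W F (f (x n)) xi0 xi_sqr (f (x m)).
      move=> /le_trans; apply.
      have : (\sum_(y <- F) rnorm (f (x n) y) * rnorm (f (x m) y)) <= t / 2 ^+ m.+1.
        apply: le_trans (xover m n mn F).
        by apply: ler_sum => y _; rewrite mulrC.
      have : 0 <= \sum_(y <- F) rnorm (f (x n) y) * rnorm (f (x m) y).
        by apply: sumr_ge0 => y _; rewrite mulr_ge0 ?rnorm_ge0.
      have : t / 2 ^+ m.+1 <= 1.
        apply: (@le_trans _ _ t); last by lra.
        by rewrite ger_pMr// invf_le1 ?exprn_gt0// exprn_ege1// ler1n.
      set a := \sum_(y <- F) _; set c := t / _ => c1 a0 ac; nra.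
    rewrite (_ : true%:R = 1 :> R)// mul1r -[leLHS]addr0; apply: lerD; last first.
      by rewrite mulr_ge0 ?invr_ge0 ?exprn_ge0// ltW.
    apply: (@le_trans _ _ (\sum_(z <- W) rnorm (h z) ^+ 2 * (1 - e))); last first.
      by rewrite -mulr_suml hsum ler_piMl.
    (* The piece lives on [B], of diameter at most [n]; more than [1 - e] of the mass of [f (x n)]
       there would make it concentrated at scale [n]. *)
    apply: ler_sum => z _; pose B := [set y | xi y z != 0].
    have hB : h z = restr B (h z).
      apply/l2_eqP => y; rewrite restrE; case: ifPn => // yB.
      rewrite /h pieceE; case: ifP => // _; have [->|xiy] := eqVneq (xi y z) 0.
        by rewrite scale0r.
      by move: yB; rewrite mem_set.
    rewrite hB inner_restr -hB.
    apply: (@le_trans _ _ ((rnorm (h z) * rnorm (restr B (f (x n)))) ^+ 2)).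
      rewrite ler_sqr ?nnegrE ?cmod_ge0 ?mulr_ge0 ?rnorm_ge0//.
      exact: cmod_inner_le.
    rewrite exprMn ler_wpM2l ?sqr_ge0// leNgt; apply/negP => Bbig.
    apply: (xbad n); exists B; split; last exact: ltW.
    by move=> y y' yB y'B; apply: le_trans Dn; exact: xidiam yB y'B.
  - rewrite /w big_split /= -mulr_suml -mulr_sumr; apply: lerD.
      rewrite ler_piMl// -natr_sum lern1.
      rewrite (eq_bigr (fun m : 'I_K => if val m == n then 1 else 0)%N); last first.
        by move=> m _; case: eqP.
      rewrite -big_mkcond sum1_card.
      apply/card_le1_eqP => i j; rewrite !unfold_in /= => /eqP hi /eqP hj.
      by apply: val_inj; rewrite /= hi hj.
    by rewrite ger_pMr// geometric_le1.
have := le_trans lower upper; lra.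
Qed.

End UnitFamily.
End Concentration.

(** * Coarse maps *)

Section Locations.
Context (R : realType) (Y : metricType R) (H : hilbertType R).
Implicit Types (u : l2 Y H) (B C : set Y).

Lemma rnorm_restr_mono B C u : B `<=` C -> rnorm (restr B u) <= rnorm (restr C u).
Proof.
move=> BC; have -> : restr B u = restr B (restr C u); last exact: rnorm_restr_le.
apply/l2_eqP => y; rewrite !restrE; case: ifPn => // yB.
by rewrite mem_set//; apply: BC; rewrite -inE.
Qed.

Lemma restr_meet B C u : rnorm u = 1 ->
  1 / 2 < rnorm (restr B u) ^+ 2 -> 1 / 2 < rnorm (restr C u) ^+ 2 ->
  exists y, B y /\ C y.
Proof.
move=> u1 uB uC; apply: contrapT => /forallNP dis.
have := rnorm_restrC B u; rewrite u1 expr1n.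
have : rnorm (restr C u) ^+ 2 <= rnorm (u - restr B u) ^+ 2.
  rewrite ler_sqr ?nnegrE ?rnorm_ge0//.
  have -> : restr C u = restr C (u - restr B u); last exact: rnorm_restr_le.
  apply/l2_eqP => y; rewrite !restrE; case: ifPn => // yC.
  rewrite l2_subE restrE; case: ifPn => [yB|_]; last by rewrite subr0.
  by have [] := dis y; split; rewrite -inE.
by move: uB uC; lra.
Qed.

(** The constant exceeds one half, so for a unit vector the ball meets any set with more than half
    of the mass, by [restr_meet]. *)
Definition located (D : R) (y : Y) u :=
  3 / 4 <= rnorm (restr [set z | mdist y z <= D] u) ^+ 2.

Lemma concentrated_located (e D : R) u : e <= 1 / 4 -> concentrated e D u ->
  exists y, located D y u.
Proof.
move=> e4 [B [BD Bu]].
have [y By] : B !=set0.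
  apply/set0P/negP => /eqP B0; move: Bu; rewrite B0.
  have -> : restr set0 u = 0.
    by apply/l2_eqP => y; rewrite restrE memNset.
  rewrite rnorm0 expr0n /=; lra.
exists y; rewrite /located; apply: (@le_trans _ _ (rnorm (restr B u) ^+ 2)); first lra.
rewrite ler_sqr ?nnegrE ?rnorm_ge0//; apply: rnorm_restr_mono => z Bz.
exact: BD.
Qed.

Lemma op_restr_far (S : l2 Y H -> l2 Y H) (M s : R) B C u w :
  linear S -> (forall u, rnorm (S u) <= M * rnorm u) ->
  (forall x y, s <= mdist x y -> forall v, entry S x y v = 0) ->
  (forall b c, B b -> C c -> s <= mdist b c) ->
  inner (S (restr C u)) (restr B w) = 0.
Proof.
move=> lS bS Ss far; rewrite innerC inner_restr.
have -> : restr B (S (restr C u)) = 0; last by rewrite inner0r conjR.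
apply/l2_eqP => b; rewrite restrE; case: ifPn => // bB.
apply: (op_value_eq0 lS bS) => c; rewrite restrE; case: ifPn => [cC|_].
  by apply: Ss; apply: far; rewrite -inE.
rewrite /entry (_ : l2_delta c 0 = 0) ?(lin0 lS)//.
by apply/l2_eqP => x; rewrite l2_deltaE; case: ifP.
Qed.

End Locations.

Lemma finite_argmax (R : realType) (T : choiceType) (A : set T) (F : T -> R) :
  finite_set A -> A !=set0 -> exists2 a, A a & forall b, A b -> F b <= F a.
Proof.
move=> fA [a0 Aa0].
suff h (s : seq T) : exists2 a, A a & forall b, b \in s -> A b -> F b <= F a.
  have [a Aa am] := h (fset_set A); exists a => // b Ab.
  by apply: am => //; rewrite in_fset_set ?inE.
elim: s => [|c s [a Aa am]]; first by exists a0.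
have [[Ac ac]|nc] := pselect (A c /\ F a <= F c).
  exists c => // b; rewrite inE => /predU1P[->//|bs Ab].
  exact: le_trans (am b bs Ab) ac.
exists a => // b; rewrite inE => /predU1P[->|]; last exact: am.
by move=> Ac; rewrite leNgt; apply/negP => /ltW ac; apply: nc.
Qed.

Section CoarseMap.
Context (R : realType) (X Y : metricType R) (HX HY : hilbertType R).
Variables (U : l2 X HX -> l2 Y HY) (V : l2 Y HY -> l2 X HX).
Hypotheses (bgX : bounded_geometry X) (bgY : bounded_geometry Y).
Hypotheses (pAY : property_A Y).
Hypotheses (uUV : unitary_pair U V) (cUV : roe_compatible U V).

(* The matrix coefficient of the conjugated displacement operator between the two
   unit vectors is one, so their locations are at most a propagation apart. *)
Lemma linked_locations (t : X -> X) (v w : X -> HX) (r D0 : R) :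
  0 <= r -> (forall x, mdist x (t x) <= r) ->
  (forall x, rnorm (v x) = 1) -> (forall x, rnorm (w x) = 1) ->
  (forall e, 0 < e -> exists D, forall x, concentrated e D (U (l2_delta x (w x)))) ->
  (forall e, 0 < e -> exists D, forall x, concentrated e D (U (l2_delta (t x) (v x)))) ->
  exists2 s, 0 < s & forall x y y', located D0 y (U (l2_delta x (w x))) ->
    located D0 y' (U (l2_delta (t x) (v x))) -> mdist y y' <= s.
Proof.
move=> r0 tr v1 w1 cw cv.
have le1 (z : X -> HX) : (forall x, rnorm (z x) = 1) -> forall x, rnorm (z x) <= 1.
  by move=> z1 x; rewrite z1.
have [T rT TE] := displacement_op bgX r0 tr (le1 v v1) (le1 w w1).
have q0 : 0 < 1 / 4 :> R by rewrite divr_gt0.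
have [S [oS [s s0 Ss] _ ST]] := cUV rT q0.
have [lS [M M0 bS]] := bounded_op_ge0 oS.
(* Two error terms [M * d] then add up to less than one half, whereas the matrix coefficient of [S]
   is at least [3 / 4]. *)
pose d : R := 1 / 4 / (M + 1).
have M1 : 0 < M + 1 by rewrite ltr_wpDl.
have d0 : 0 < d by rewrite divr_gt0.
have dM : d * (M + 1) = 1 / 4 by rewrite divfK// gt_eqF.
have d4 : d <= 1 / 4 by nra.
have d2 : 0 < d ^+ 2 by rewrite exprn_gt0.
have [D1 cw1] := cw _ d2; have [D2 cv2] := cv _ d2.
(* The bound follows the chain [y, z, b, b', z', y'] found below; the absolute values are there
   because the radii may be negative. *)
exists (`|D0| + `|D1| + s + (`|D2| + `|D0|)) => [|x y y'].
  by rewrite ltr_wpDr ?addr_ge0// ltr_wpDl// addr_ge0.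
set f := U (l2_delta x (w x)); set f' := U (l2_delta (t x) (v x)) => ly ly'.
have f1 : rnorm f = 1 by rewrite /f (unitary_rnorm uUV) rnorm_delta.
have f'1 : rnorm f' = 1 by rewrite /f' (unitary_rnorm uUV) rnorm_delta.
have [_ UK VK iUV] := uUV.
have QE : inner (U (T (V f'))) f = 1.
  rewrite /f iUV /f' UK innerC inner_delta TE l2_deltaE eqxx inner_self v1 expr1n.
  by rewrite scale1r inner_self w1 expr1n conjR.
have [B [BD Bf]] := cw1 x; have [B' [BD' Bf']] := cv2 x.
rewrite -/f in Bf; rewrite -/f' in Bf'.
have tail (C : set Y) (g : l2 Y HY) : rnorm g = 1 ->
    1 - d ^+ 2 <= rnorm (restr C g) ^+ 2 -> rnorm (g - restr C g) <= d.
  move=> g1 gC; rewrite rnorm_le_sqr ?(ltW d0)//.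
  by have := rnorm_restrC C g; rewrite g1 expr1n; lra.
have [b [b' [Bb B'b' bb']]] : exists b b', [/\ B b, B' b' & mdist b b' < s].
  apply: contrapT => nb.
  have far b b' : B b -> B' b' -> s <= mdist b b'.
    by move=> Bb Bb'; rewrite leNgt; apply/negP => h; apply: nb; exists b, b'.
  have z := op_restr_far f' f lS bS Ss far.
  have e1 : 3 / 4 <= re (inner (S f') f).
    have := re_inner_le (U (T (V f')) - S f') f; rewrite innerBl reD reN QE f1 mulr1.
    by have := ST f'; rewrite f'1 mulr1 /=; lra.
  (* The block from [B'] to [B] vanishes by finite propagation, so only the tails of [f] and [f']
     contribute. *)
  have e2 : re (inner (S f') f) = re (inner (S (f' - restr B' f')) f) +
      re (inner (S (restr B' f')) (f - restr B f)).
    by rewrite innerBr z subr0 (linB lS) innerBl reD reN addrNK.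
  have e3 : re (inner (S (f' - restr B' f')) f) <= M * d.
    apply: le_trans (re_inner_le _ _) _; rewrite f1 mulr1.
    by apply: le_trans (bS _) _; rewrite ler_wpM2l// tail.
  have e4 : re (inner (S (restr B' f')) (f - restr B f)) <= M * d.
    have SM : rnorm (S (restr B' f')) <= M.
      apply: le_trans (bS _) _; rewrite -[leRHS]mulr1 ler_wpM2l//.
      by rewrite -f'1 rnorm_restr_le.
    apply: le_trans (re_inner_le _ _) _.
    exact: ler_pM (rnorm_ge0 _) (rnorm_ge0 _) SM (tail _ _ f1 Bf).
  by move: dM; rewrite mulrDr mulr1; lra.
have sq : d ^+ 2 <= 1 / 4 by nra.
have [z [Bz yz]] : exists z, B z /\ mdist y z <= D0.
  by apply: (restr_meet f1); [lra|move: ly; rewrite /located; lra].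
have [z' [Bz' yz']] : exists z, B' z /\ mdist y' z <= D0.
  by apply: (restr_meet f'1); [lra|move: ly'; rewrite /located; lra].
have := metric_triangle y z y'; have := metric_triangle z b y'.
have := metric_triangle b b' y'; have := metric_triangle b' z' y'.
have := BD _ _ Bz Bb; have := BD' _ _ B'b' Bz'; rewrite (metric_sym z' y').
have := ler_norm D0; have := ler_norm D1; have := ler_norm D2; lra.
Qed.

Variable k : HX.
Hypothesis k1 : rnorm k = 1.

Definition locates (D : R) (f : X -> Y) :=
  forall x, located D (f x) (U (l2_delta x k)).

Lemma locating_map : exists D f, locates D f.
Proof.
have [] := site_image_concentrated bgX bgY pAY uUV cUV (v := fun=> k) _ (e := 1 / 4).
- by [].
- by rewrite divr_gt0.
move=> D hD; exists D.
have /choice[f fD] x : exists y, located D y (U (l2_delta x k)).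
  exact: concentrated_located (lexx _) (hD x).
by exists f.
Qed.

(** One displacement serves all pairs: [t] sends [x] to the point of its [r]-ball whose image is
    farthest from [f x]. *)
Lemma locating_map_expansive D f : locates D f -> uniformly_expansive f.
Proof.
move=> fD r r0.
have /choice[t tP] x : exists t, mdist x t <= r /\
    forall z, mdist x z <= r -> mdist (f x) (f z) <= mdist (f x) (f t).
  have [N [b [bE _]]] := bounded_geometry_fset bgX (ltW r0).
  have fin : finite_set [set z | mdist x z <= r].
    rewrite (_ : [set _ | _] = [set` b x])//.
    by apply/seteqP; split => z /=; rewrite bE.
  have [|t xt tmax] := finite_argmax (fun z => mdist (f x) (f z)) fin.
    by exists x; rewrite /= mdistxx ltW.
  by exists t.
have conc e : 0 < e -> exists D, forall x, concentrated e D (U (l2_delta x k)).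
  by move=> e0; apply: (site_image_concentrated bgX bgY pAY uUV cUV (v := fun=> k)).
have conct e : 0 < e -> exists D, forall x, concentrated e D (U (l2_delta (t x) k)).
  by move=> /conc[D' hD']; exists D' => x.
have [s s0 hs] := linked_locations D (ltW r0) (fun x => (tP x).1)
  (fun=> k1) (fun=> k1) conc conct.
exists s => // x x' xx'; apply: le_trans (hs x _ _ (fD x) (fD (t x))).
exact: (tP x).2.
Qed.

End CoarseMap.

(** * Compositions close to the identity *)

Section Closeness.
Context (R : realType) (X Y : metricType R) (HX HY : hilbertType R).
Variables (U : l2 X HX -> l2 Y HY) (V : l2 Y HY -> l2 X HX).
Hypotheses (bgX : bounded_geometry X) (bgY : bounded_geometry Y).
Hypotheses (pAX : property_A X).
Hypotheses (uUV : unitary_pair U V).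
Hypotheses (cUV : roe_compatible U V) (cVU : roe_compatible V U).
Variables (h : HX) (k : HY).
Hypotheses (h1 : rnorm h = 1) (k1 : rnorm k = 1).

Let uVU := unitary_pair_sym uUV.

Lemma located_le (D D' : R) x (u : l2 X HX) : D <= D' -> located D x u -> located D' x u.
Proof.
move=> DD /le_trans; apply; rewrite ler_sqr ?nnegrE ?rnorm_ge0//.
by apply: rnorm_restr_mono => z /= /le_trans; apply.
Qed.

(* w is the direction of the value at y coming from the site farthest from g y, so
   that comparing w with k, once for each y, controls all sites seen at y. *)
Lemma far_witness (c : R) (g : Y -> X) y : 0 < c ->
  exists w : HY, rnorm w = 1 /\
    forall x, c <= rnorm (U (l2_delta x h) y) -> exists x',
      c <= cmod (inner w (U (l2_delta x' h) y)) /\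
      mdist (g y) x <= mdist (g y) x'.
Proof.
move=> c0; have fin := site_image_vanishing bgX bgY uUV cUV (fun=> h1) y c0.
have [[x xc]|none] := pselect (exists x, c <= rnorm (U (l2_delta x h) y)); last first.
  by exists k; split=> // x xc; case: none; exists x.
have [x' x'c x'max] := finite_argmax (mdist (g y)) fin (ex_intro _ x xc).
rewrite /= /site_image in x'c; set u := U (l2_delta x' h) y in x'c.
have u0 : u != 0.
  by apply/eqP => u0; move: x'c; rewrite u0 rnorm0 leNgt c0.
exists ((rnorm u)^-1%:C *: u); split; first exact: rnorm_normalize.
move=> z zc; exists x'; split; last exact: x'max.
rewrite -/u innerZl inner_self -rmorphM cmodR expr2 mulKf ?gt_eqF ?rnorm_gt0//.
by rewrite ger0_norm ?rnorm_ge0.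
Qed.

(** Some [y] near [f x] sees the site [x] with value at least [c]. Of the sites so seen, one
    farthest from [g y] is a location for the direction [w y] at [y], while [g y] is a location for
    [k]; linking the two directions bounds the distance from [g y] to [x]. Expansiveness of [g] then
    replaces [y] by [f x]. *)
Lemma locating_maps_close D D' (f : X -> Y) (g : Y -> X) :
  locates U h D f -> locates V k D' g -> close_maps (g \o f) id.
Proof.
move=> fD gD'.
have D0 : 0 <= `|D| + 1 by rewrite addr_ge0.
have [N [b [bE bN]]] := bounded_geometry_fset bgY D0.
(* If the at most [N] values near [f x] were all below [c], the mass there would be at most
   [N * c ^ 2], short of [3 / 4]. *)
pose c : R := 1 / 2 / (N%:R + 1).
have N1 : 0 < N%:R + 1 :> R by rewrite ltr_wpDl.
have c0 : 0 < c by rewrite !divr_gt0.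
have cN : c * (N%:R + 1) = 1 / 2 by rewrite divfK// gt_eqF.
have N0 := ler0n R N.
have c2 : c <= 1 / 2 by nra.
have /choice[j jP] x : exists y, mdist (f x) y <= `|D| + 1 /\
    c <= rnorm (U (l2_delta x h) y).
  apply: contrapT => /forallNP no; have := fD x; rewrite /located.
  apply/negP; rewrite -ltNge; set u := U (l2_delta x h).
  apply: (@le_lt_trans _ _ (rnorm (restr [set` b (f x)] u) ^+ 2)).
    rewrite ler_sqr ?nnegrE ?rnorm_ge0//; apply: rnorm_restr_mono => z /= zD.
    by rewrite bE; apply: le_trans zD _; rewrite (le_trans (ler_norm D))// lerDl.
  rewrite rnorm_restr_fset; apply: (@le_lt_trans _ _ (\sum_(y <- b (f x)) c ^+ 2)).
    rewrite big_seq [leRHS]big_seq; apply: ler_sum => y; rewrite bE => yD.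
    rewrite ler_sqr ?nnegrE ?rnorm_ge0 ?(ltW c0)// leNgt; apply/negP => /ltW cy.
    by apply: (no y).
  rewrite big_const_seq count_predT iter_addr addr0 -[ltLHS]mulr_natl.
  apply: (@le_lt_trans _ _ (N%:R * c ^+ 2)).
    by rewrite ler_wpM2r ?sqr_ge0// ler_nat bN.
  nra.
have /choice[w /all_and2[w1 wP]] y := far_witness g y c0.
have conc (v : Y -> HY) : (forall y, rnorm (v y) = 1) ->
    forall e, 0 < e -> exists D, forall y, concentrated e D (V (l2_delta y (v y))).
  by move=> v1 e e0; exact: (site_image_concentrated bgY bgX pAX uVU cVU v1).
have [D1 hD1] : exists D1, forall y x', c <= cmod (inner (w y) (U (l2_delta x' h) y)) ->
    located D1 x' (V (l2_delta y (w y))).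
  (* The site [x'] carries at least [c ^ 2] of the mass, so a set missing at most [c ^ 2 / 2] must
     contain it. *)
  have cc : 0 < c ^+ 2 / 2 by rewrite divr_gt0// exprn_gt0.
  have [D1 hD1] := conc w w1 _ cc; exists D1 => y x' cx'.
  have [B [BD Bm]] := hD1 y; set u := V (l2_delta y (w y)) in Bm *.
  have u1 : rnorm u = 1 by rewrite /u (unitary_rnorm uVU) rnorm_delta.
  have cu : c <= rnorm (u x').
    apply: le_trans cx' _; rewrite -inner_delta -(unitary_inner uVU) -/u.
    rewrite innerC cmodJ inner_delta; apply: le_trans (cmod_inner_le _ _) _.
    by rewrite h1 mul1r.
  have Bx' : B x'.
    apply: contrapT => nB; have := rnorm_restrC B u; rewrite u1 expr1n.
    have := l2_rnorm_pt_le (u - restr B u) x'.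
    rewrite l2_subE restrE memNset// subr0 => cu'.
    have : c ^+ 2 <= rnorm (u - restr B u) ^+ 2.
      by rewrite ler_sqr ?nnegrE ?rnorm_ge0 ?(ltW c0)// (le_trans cu).
    have : 0 < c ^+ 2 by rewrite exprn_gt0.
    by move: Bm; lra.
  rewrite /located; apply: (@le_trans _ _ (rnorm (restr B u) ^+ 2)).
    have : c ^+ 2 <= 1 / 4 by nra.
    by move: Bm; lra.
  rewrite ler_sqr ?nnegrE ?rnorm_ge0//; apply: rnorm_restr_mono => z Bz.
  exact: BD.
have id0 y : mdist y (id y : Y) <= 0 by rewrite mdistxx.
have [s s0 hs] := linked_locations bgY uVU cVU (Num.max D' D1) (lexx 0) id0
  w1 (fun=> k1) (conc (fun=> k) (fun=> k1)) (conc w w1).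
have gj x : mdist (g (j x)) x <= s.
  have [x' [cx' xx']] := wP (j x) x (jP x).2.
  apply: le_trans xx' _; apply: (hs (j x)).
    by apply: located_le (gD' (j x)); rewrite le_max lexx.
  by apply: located_le (hD1 _ _ cx'); rewrite le_max lexx orbT.
have r0 : 0 < `|D| + 1 by rewrite ltr_wpDl.
have [s' s'0 hs'] := locating_map_expansive bgY bgX pAX uVU cVU k1 gD' r0.
exists (s' + s) => [|x]; first exact: addr_gt0.
apply: le_trans (metric_triangle _ (g (j x)) _) _.
by apply: lerD; [apply: hs'; exact: (jP x).1 | exact: gj].
Qed.

End Closeness.

Lemma unitary_coarse_equivalence (R : realType) (X Y : metricType R)
    (HX HY : hilbertType R) (U : l2 X HX -> l2 Y HY) (V : l2 Y HY -> l2 X HX)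
    (h : HX) (k : HY) :
  bounded_geometry X -> property_A X -> bounded_geometry Y -> property_A Y ->
  unitary_pair U V -> roe_compatible U V -> roe_compatible V U ->
  rnorm h = 1 -> rnorm k = 1 -> coarsely_equivalent X Y.
Proof.
move=> bgX pAX bgY pAY uUV cUV cVU h1 k1; have uVU := unitary_pair_sym uUV.
have [D [f fD]] := locating_map bgX bgY pAY uUV cUV h1.
have [D' [g gD']] := locating_map bgY bgX pAX uVU cVU k1.
exists f, g; split.
- exact: (locating_map_expansive bgX bgY pAY uUV cUV h1 fD).
- exact: (locating_map_expansive bgY bgX pAX uVU cVU k1 gD').
- exact: (locating_maps_close bgY bgX pAY uVU cVU cUV k1 h1 gD' fD).
- exact: (locating_maps_close bgX bgY pAX uUV cUV cVU h1 k1 fD gD').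
Qed.

(** * Spatial implementation of isomorphisms *)

Section OperatorNorm.
Context (R : realType) (E : hilbertType R).
Implicit Types (T S : E -> E) (u v w : E).

Lemma opnorm_le T (M : R) : 0 <= M -> (forall u, rnorm (T u) <= M * rnorm u) ->
  opnorm T <= M.
Proof.
move=> M0 bT; apply: ge_inf; last by split.
by exists 0 => N [].
Qed.

Lemma opnorm_lt T (e : R) : bounded_op T -> opnorm T < e ->
  forall u, rnorm (T u) <= e * rnorm u.
Proof.
move=> oT Te u; have [_ [M M0 bT]] := bounded_op_ge0 oT.
have [|N [N0 bN] Ne] := inf_lt _ Te.
  by exists M.
by apply: le_trans (bN u) _; rewrite ler_wpM2r ?rnorm_ge0// ltW.
Qed.

Lemma bounded_opB T S : bounded_op T -> bounded_op S -> bounded_op (T \- S).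
Proof.
move=> oT oS; have [lT [M M0 bT]] := bounded_op_ge0 oT.
have [lS [N N0 bS]] := bounded_op_ge0 oS; split=> [a u v|].
  by rewrite /= lT lS scalerBr opprD addrACA.
exists (M + N) => u; rewrite mulrDl; apply: le_trans (ler_rnormD _ _) _.
by rewrite rnormN lerD.
Qed.

Definition rank_one v w : E -> E := fun u => inner u w *: v.

Lemma rank_one_le v w u : rnorm (rank_one v w u) <= rnorm v * rnorm w * rnorm u.
Proof.
rewrite /rank_one rnormZ -/(cmod _) mulrC -mulrA ler_wpM2l ?rnorm_ge0//.
by rewrite mulrC cmod_inner_le.
Qed.

Lemma rank_one_linear v w : linear (rank_one v w).
Proof. by move=> a u u'; rewrite /rank_one innerDl innerZl scalerDl scalerA. Qed.

Lemma rank_one_bounded v w : bounded_op (rank_one v w).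
Proof.
split; first exact: rank_one_linear.
by exists (rnorm v * rnorm w) => u; exact: rank_one_le.
Qed.

Lemma rank_one_adjoint v w : is_adjoint (rank_one v w) (rank_one w v).
Proof.
move=> a b; rewrite /rank_one innerZl innerZr (innerC b v).
by rewrite [Num.conj _]conjcK mulrC.
Qed.

Lemma rank_oneDl v v' w : rank_one (v + v') w = rank_one v w \+ rank_one v' w.
Proof. by apply/funext => u; rewrite /rank_one /= scalerDr. Qed.

Lemma rank_oneZl (a : R[i]) v w : rank_one (a *: v) w = a \*: rank_one v w.
Proof. by apply/funext => u; rewrite /rank_one /= !scalerA mulrC. Qed.

Lemma comp_rank_one T v w : linear T -> T \o rank_one v w = rank_one (T v) w.
Proof. by move=> lT; apply/funext => u; rewrite /= /rank_one (linZ lT). Qed.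

End OperatorNorm.

Section RoeAlgebras.
Context (R : realType) (X : metricType R) (H : hilbertType R).
Variable A0 : set (l2 X H -> l2 X H).
Hypothesis roeA0 : algebraic_roe_type A0.

(** Entries vanish outside a finite set of pairs, so a diameter bounds the propagation, and each
    entry has rank at most one. *)
Lemma finite_rank_one_roe (v w : l2 X H) (A B : {fset X}) :
  A0 (rank_one (restr [set` A] v) (restr [set` B] w)).
Proof.
have [_ _ inA0] := roeA0; apply: inA0; first exact: rank_one_bounded.
  have [D hD] := fset_diam (A `|` B)%fset.
  exists (`|D| + 1) => [|x y xy u]; first by rewrite ltr_wpDl.
  rewrite /entry /rank_one l2_scaleE inner_delta !restrE.
  case: ifPn => [yB|_]; last by rewrite inner0r scale0r.
  case: ifPn => [xA|_]; last by rewrite scaler0.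
  have := hD x y; rewrite !inE in yB xA *.
  rewrite yB xA orbT => /(_ isT isT) => h.
  by exfalso; have := ler_norm D; move: (le_trans xy h); lra.
exists 1%N => x y; exists (fun=> restr [set` A] v x) => u.
by exists (fun=> inner (l2_delta y u) (restr [set` B] w)); rewrite big_ord1.
Qed.

(** A rank one operator depends norm-continuously on its two vectors, which are limits of finitely
    supported ones. *)
Lemma rank_one_roe (v w : l2 X H) : norm_closure A0 (rank_one v w).
Proof.
split=> [|e e0]; first exact: rank_one_bounded.
have n0 : 0 < rnorm v + rnorm w + 1 by rewrite ltr_wpDl// addr_ge0 ?rnorm_ge0.
pose d := e / 2 / (rnorm v + rnorm w + 1).
have d0 : 0 < d by rewrite !divr_gt0.
have dE : d * (rnorm v + rnorm w + 1) = e / 2 by rewrite divfK// gt_eqF.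
have [A hA] := restr_approx v d0; have [B hB] := restr_approx w d0.
exists (rank_one (restr [set` A] v) (restr [set` B] w)).
  exact: finite_rank_one_roe.
apply: (@le_lt_trans _ _ (e / 2)); last by rewrite ltr_pdivrMr//; lra.
apply: opnorm_le => [|u]; first by rewrite divr_ge0 ?ltW.
set v' := restr _ v in hA *; set w' := restr _ w in hB *.
have -> : (rank_one v w \- rank_one v' w') u =
    rank_one (v - v') w u + rank_one v' (w - w') u.
  by rewrite /rank_one /= innerBr scalerBr scalerBl addrA subrK.
apply: le_trans (ler_rnormD _ _) _.
apply: le_trans (lerD (rank_one_le _ _ _) (rank_one_le _ _ _)) _.
rewrite -mulrDl ler_wpM2r ?rnorm_ge0//.
have v'v : rnorm v' <= rnorm v by exact: rnorm_restr_le.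
have := ler_pM (rnorm_ge0 _) (rnorm_ge0 _) v'v hB.
have := ler_wpM2r (rnorm_ge0 w) hA.
by move: dE; rewrite !mulrDr mulr1; have := ltW d0; lra.
Qed.

End RoeAlgebras.

Section Implementation.
Context (R : realType) (E F : hilbertType R) (A : set (E -> E)) (B : set (F -> F)).
Variable phi : (E -> E) -> (F -> F).
Hypotheses (starA : star_subalgebra A) (starB : star_subalgebra B).
Hypotheses (roA : forall v w : E, A (rank_one v w)).
Hypotheses (roB : forall v w : F, B (rank_one v w)).
Hypothesis iso : star_isomorphism A B phi.

(* With f0 a unit vector in the range of the projection phi(|e0><e0|), the
   unitary is U v = phi(|v><e0|) f0. *)
Lemma star_isomorphism_spatial (e0 : E) : rnorm e0 = 1 ->
  exists U V, unitary_pair U V /\ forall T, A T -> phi T \o U = U \o T.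
Proof.
move=> e01; have [[phiB phiI phiS] phiD phiZ phiM phiadj] := iso.
have [Ab _ _ _ _] := starA; have [Bb _ _ _ _] := starB.
have lin T : A T -> linear T by move=> /Ab[].
have blin T : B T -> linear T by move=> /Bb[].
pose p := rank_one e0 e0.
have pp : p \o p = p.
  apply/funext => u; rewrite /p /rank_one /= innerZl inner_self e01 expr1n.
  by rewrite mulr1.
have Ap : A p by exact: roA.
have qq u : phi p (phi p u) = phi p u by rewrite -[in RHS]pp phiM.
have phi0 : phi (fun=> 0) = fun=> 0.
  rewrite (_ : (fun=> 0) = 0 \*: p); last by apply/funext => u /=; rewrite scale0r.
  by rewrite phiZ//; apply/funext => u /=; rewrite scale0r.
have [u0 qu0] : exists u, phi p u != 0.
  apply: contrapT => /forallNP q0; have : p = fun=> 0.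
    apply: phiI; rewrite ?inE//; first by case: starA.
    by rewrite phi0; apply/funext => u; have /negP/negPn/eqP := q0 u.
  move/(congr1 (fun T => T e0)); rewrite /p /rank_one inner_self e01 expr1n.
  rewrite scale1r => e00; move: e01; rewrite e00 rnorm0 => /eqP.
  by rewrite eq_sym oner_eq0.
pose f0 := (rnorm (phi p u0))^-1%:C *: phi p u0.
have f01 : rnorm f0 = 1 by exact: rnorm_normalize.
have qlin : linear (phi p) by apply: blin; apply: phiB; exact: roA.
have qf0 : phi p f0 = f0 by rewrite /f0 (linZ qlin) qq.
pose U v := phi (rank_one v e0) f0.
have UD a u v : U (a *: u + v) = a *: U u + U v.
  rewrite /U rank_oneDl rank_oneZl phiD//; last by rewrite -rank_oneZl.
  by rewrite phiZ.
have comm T v : A T -> phi T (U v) = U (T v).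
  move=> AT; rewrite /U -[LHS]/((phi T \o phi (rank_one v e0)) f0) -phiM//.
  by rewrite (comp_rank_one _ _ (lin _ AT)).
(* The product of [rank_one e0 v] and [rank_one u e0] is [inner u v] times [p], and [phi p] fixes
   [f0]. *)
have iU u v : inner (U u) (U v) = inner u v.
  have adj := phiadj (rank_one e0 v) (rank_one v e0) (roA _ _) (roA _ _)
    (@rank_one_adjoint _ _ v e0).
  rewrite innerC adj -[X in inner _ X]/((phi (rank_one e0 v) \o phi (rank_one u e0)) f0).
  rewrite -phiM// (_ : _ \o _ = inner u v \*: p); last first.
    by apply/funext => x; rewrite /p /rank_one /= innerZl scalerA mulrC.
  rewrite phiZ//= qf0 innerZr inner_self f01 expr1n mulr1.
  exact: conjcK.
(* If [phi T] is [rank_one u f0], then [U (T e0) = phi T (U e0) = phi T f0 = u]. *)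
have surj u : exists v, U v = u.
  have [T AT TE] := phiS _ (roB u f0); exists (T e0).
  rewrite -comm// TE.
  rewrite /U -/p qf0 /rank_one inner_self f01 expr1n scale1r//.
have /choice[V VK] := surj.
exists U, V; split; last by move=> T AT; apply/funext => v; exact: comm.
split=> // u; have lU : linear U by [].
apply: rnorm_inj; set d := V (U u) - u.
have : rnorm (U d) ^+ 2 = 0 by rewrite /d (linB lU) VK subrr rnorm0 expr0n.
by rewrite -re_inner_self iU re_inner_self => /eqP; rewrite sqrf_eq0 => /eqP.
Qed.

End Implementation.

(** * From isomorphic algebras to coarse equivalence *)

Lemma norm_closure_compatible (R : realType) (X Y : metricType R)
    (HX HY : hilbertType R) (U : l2 X HX -> l2 Y HY) (V : l2 Y HY -> l2 X HX)
    (A0 : set (l2 X HX -> l2 X HX)) (B0 : set (l2 Y HY -> l2 Y HY)) :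
  algebraic_roe_type A0 -> algebraic_roe_type B0 ->
  (forall T, norm_closure A0 T -> norm_closure B0 (U \o T \o V)) ->
  roe_compatible U V.
Proof.
move=> [_ _ inA0] [[B0b _ _ _ _] B0P _] AB T [oT pT rT] e e0.
(* Entries of rank at most one satisfy the uniform rank condition, so [T] lies in every algebraic
   Roe-type algebra. *)
have A0T : A0 T by apply: inA0 => //; exists 1%N.
have [|oQ apx] := AB T.
  split=> // d d0; exists T => //; apply: le_lt_trans d0.
  by apply: opnorm_le => // u; rewrite /= subrr rnorm0 mul0r.
have [S B0S QS] := apx e e0; exists S; have [lS pS] := B0P _ B0S.
split=> //; first exact: B0b.
by apply: opnorm_lt => //; apply: bounded_opB => //; exact: B0b.
Qed.

Theorem theorem4p1 (R : realType) (X Y : metricType R) (HX HY : hilbertType R)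
    (AX : set (l2 X HX -> l2 X HX)) (AY : set (l2 Y HY -> l2 Y HY)) :
  bounded_geometry X -> property_A X ->
  bounded_geometry Y -> property_A Y ->
  separable HX -> (exists v : HX, v != 0) ->
  separable HY -> (exists v : HY, v != 0) ->
  roe_type_algebra AX -> roe_type_algebra AY ->
  (exists phi : (l2 X HX -> l2 X HX) -> (l2 Y HY -> l2 Y HY),
     star_isomorphism AX AY phi) ->
  coarsely_equivalent X Y.
Proof.
move=> bgX pAX bgY pAY _ [h h0] _ [k k0] [[starA _] [A0 roeA0 AE]].
move=> [[starB _] [B0 roeB0 BE]] [phi iso].
have h1 := rnorm_normalize h0; have k1 := rnorm_normalize k0.
set h' := _ *: h in h1; set k' := _ *: k in k1.
have roA v w : AX (rank_one v w) by rewrite AE; exact: rank_one_roe.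
have roB v w : AY (rank_one v w) by rewrite BE; exact: rank_one_roe.
have [[phiB phiI phiS] _ _ _ _] := iso.
(* With no site in [X] there is no unit vector to start from. All operators on [l2 X HX] then
   coincide, hence so do all elements of [AY]; a point of [Y] would give a nonzero rank one operator
   equal to zero. *)
have [[x0 _]|Xempty] := pselect (exists x : X, True); last first.
  have noX (x : X) : False by apply: Xempty; exists x.
  have noY (y : Y) : False.
    have [T AT TE] := phiS _ (roB (l2_delta y k') (l2_delta y k')).
    have [S AS SE] := phiS _ (roB 0 0).
    have TS : T = S by apply/funext => u; apply/l2_eqP => x; case: (noX x).
    have : rank_one (l2_delta y k') (l2_delta y k') = rank_one 0 0.
      by rewrite -TE -SE TS.
    move/(congr1 (fun T => T (l2_delta y k'))).
    rewrite /rank_one inner_self rnorm_delta k1 expr1n scale1r scaler0.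
    by move/(congr1 (@rnorm _ _)); rewrite rnorm_delta k1 rnorm0 => /eqP; rewrite oner_eq0.
  exists (fun x => False_rect Y (noX x)), (fun y => False_rect X (noY y)).
  split; [| |by exists 1 => // y; case: (noY y)|by exists 1 => // x; case: (noX x)].
    by move=> r _; exists 1 => // x; case: (noX x).
  by move=> r _; exists 1 => // y; case: (noY y).
have e1 : rnorm (l2_delta x0 h') = 1 by rewrite rnorm_delta.
have [U [V [uUV comm]]] := star_isomorphism_spatial starA starB roA roB iso e1.
have [lU UK VK iU] := uUV.
(* On [AX] conjugation by [U] is [phi] itself. *)
have AB T : AX T -> AY (U \o T \o V).
  move=> AT; rewrite (_ : _ \o V = phi T); first exact: phiB.
  apply/funext => u; rewrite -[LHS]/((U \o T) (V u)) -comm//=.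
  by rewrite VK.
have BA T : AY T -> AX (V \o T \o U).
  move=> /phiS[S AS <-]; rewrite (_ : _ \o U = S)//.
  apply/funext => u; rewrite -[LHS]/(V ((phi S \o U) u)) comm//=.
rewrite AE in AB BA; rewrite BE in AB BA.
exact: (unitary_coarse_equivalence bgX pAX bgY pAY uUV
  (norm_closure_compatible roeA0 roeB0 AB)
  (norm_closure_compatible roeB0 roeA0 BA) h1 k1).
Qed.
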